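(* Let $(X,d,\mathfrak m)$ be a metric measure space and $p\in[1,\infty)$. Then the following hold. (i) Let $f:X\to[-\infty,\infty]$ be $\mathfrak m$-measurable with $\mathrm{WUG}_N(f)\neq\varnothing$. Then $\rho_f=0$ $\mathfrak m$-a.e. on $\{x\in X: |f(x)|=+\infty\}$, and $\rho_f=0$ $\mathfrak m$-a.e. on $f^{-1}(N)$ whenever $N\subseteq\mathbb R$ is a Borel set with $\mathcal L^1(N)=0$. (ii) (Chain rule) Let $f:X\to\mathbb R$ be $\mathfrak m$-measurable with $\mathrm{WUG}_N(f)\ne\varnothing$. If $\varphi:\mathbb R\to\mathbb R$ is Lipschitz and $g=\varphi\circ f$, then $\mathrm{WUG}_N(g)\neq\varnothing$ and $\rho_g=(\mathrm{lip}(\varphi)\circ f)\,\rho_f$ $\mathfrak m$-a.e. More generally, let $f:X\to[-\infty,\infty]$ be $\mathfrak m$-measurable with $\mathrm{WUG}_N(f)\ne\varnothing$, let $\varphi:\mathbb R\to\mathbb R$ be Lipschitz, and let $g(x)=\varphi(f(x))$ if $f(x)\in\mathbb R$ and $g(x)=0$ if $|f(x)|=+\infty$. Then $\mathrm{WUG}_N(g)\neq\varnothing$ and, $\mathfrak m$-a.e., $\rho_g=(\mathrm{lip}(\varphi)\circ f)\,\rho_f$ on $\{|f|<\infty\}$ and $\rho_g=0$ on $\{|f|=+\infty\}$. (iii) (Locality) Let $f,g:X\to[-\infty,\infty]$ be $\mathfrak m$-measurable with $\mathrm{WUG}_N(f)\neq\varnothing$ and $\mathrm{WUG}_N(g)\ne\varnothing$.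 Then $\mathrm{WUG}_N(f-g)\neq\varnothing$ and $\rho_{(f-g)}=0$ $\mathfrak m$-a.e. on $\{f=g\}$. (iv) (Leibniz rule) Let $f,g:X\to[-\infty,\infty]$ be $\mathfrak m$-measurable with $\mathrm{WUG}_N(f)\neq\varnothing$, $\mathrm{WUG}_N(g)\ne\varnothing$ and $|f|+|g|\le C$ $\mathfrak m$-a.e. in $X$ for some constant $C$. Then $\mathrm{WUG}_N(fg)\ne\varnothing$ and $\rho_{fg}\le|f|\rho_g+|g|\rho_f$ $\mathfrak m$-a.e. on $X$.
   Context: A metric measure space $(X,d,\mathfrak m)$ is a complete separable metric space with a non-negative Borel measure $\mathfrak m$ finite on bounded sets. ''$\mathfrak m$-measurable'' means measurable with respect to the $\mathfrak m$-completion of the Borel $\sigma$-algebra. A curve is a continuous map $\gamma:[a_\gamma,b_\gamma]\to X$, $a_\gamma<b_\gamma$; $\mathscr C(X)$ is the set of all curves, $\mathscr R(X)$ the set of those of finite length $\ell(\gamma)$. For $\gamma\in\mathscr R(X)$, $s_\gamma$ is the Borel measure on $[a_\gamma,b_\gamma]$ with $s_\gamma([s,t])=\ell(\gamma|_{[s,t]})$, and $\int_\gamma\rho\,ds=\int\rho\circ\gamma\,ds_\gamma$ for Borel $\rho:X\to[0,\infty]$; if $\ell(\gamma)=\infty$, $\int_\gamma\rho\,ds=+\infty$. $\mathrm{Mod}_p(\Gamma)=\inf\int\rho^p\,d\mathfrak m$ over Borel $\rho:X\to[0,\infty]$ with $\int_\gamma\rho\,ds\ge1$ for all $\gamma\in\Gamma$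 ($\inf\varnothing=\infty$). For an arbitrary $f:X\to[-\infty,\infty]$, $\mathrm{WUG}_N(f)$ is the set of Borel $\rho:X\to[0,\infty]$ with $\int\rho^p\,d\mathfrak m<\infty$ such that for $\mathrm{Mod}_p$-a.e. nonconstant $\gamma\in\mathscr R(X)$ the values $f(\gamma_{a_\gamma})$, $f(\gamma_{b_\gamma})$ are finite and $|f(\gamma_{b_\gamma})-f(\gamma_{a_\gamma})|\le\int_\gamma\rho\,ds$. When $\mathrm{WUG}_N(f)\ne\varnothing$, $\rho_f$ denotes any element of $\mathrm{WUG}_N(f)$ of minimal $L^p(\mathfrak m)$-seminorm (it exists and is unique up to $\mathfrak m$-a.e. equality). For $\varphi:\mathbb R\to\mathbb R$ Lipschitz, $\mathrm{lip}(\varphi)(t)=\limsup_{s\to t}|\varphi(s)-\varphi(t)|/|s-t|$. At points where $f-g$ or $fg$ is an indeterminate expression an arbitrary value is assigned. *)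

(* Defs.v *)
From HB Require Import structures.
From mathcomp Require Import all_boot all_order all_algebra.
From mathcomp Require Import all_classical all_reals all_analysis measurable_realfun.
From mathcomp Require Import lra.
Set Implicit Arguments.
Unset Strict Implicit.
Unset Printing Implicit Defensive.
Import Order.TTheory GRing.Theory Num.Theory.
Import numFieldNormedType.Exports.
Local Open Scope classical_set_scope.
Local Open Scope ring_scope.

#[short(type="completeMetricType")]
HB.structure Definition CompleteMetric (R : numDomainType) :=
  { T of Metric R T & CompletePseudoMetric R T }.

Definition separable (T : topologicalType) :=
  exists2 D : set T, countable D & dense D.

Definition borelType (T : ptopologicalType) := g_sigma_algebraType (@open T).

Definition finite_on_bounded (R : realType) (X : completeMetricType R)
    (m : set (borelType X) -> \bar R) :=
  forall A : set (borelType X), measurable A ->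
    (exists (x : X) (r : R), A `<=` ball x r) -> (m A < +oo)%E.

Section completion.
Context d (T : measurableType d) (R : realType) (m : set T -> \bar R).

Definition completion_measurable (A : set T) :=
  exists B N, [/\ measurable B, m.-negligible N & A = B `|` N].

Definition completion_measurable_fun d' (U : measurableType d') (f : T -> U) :=
  forall Y, measurable Y -> completion_measurable (f @^-1` Y).

End completion.

Section curves.
Context (R : realType) (X : metricType R).

(* Only the values of [curve_fun] on [curve_start, curve_stop] are meaningful. *)
Record curve := Curve {
  curve_start : R ;
  curve_stop : R ;
  curve_fun :> R -> X ;
  curve_lt : curve_start < curve_stop ;
  curve_continuous : {within `[curve_start, curve_stop], continuous curve_fun} }.

(* [zip] truncates: for p = [:: t1; ..; tn], the sum ranges over the pairs
   (s, t1), (t1, t2), .., (tn-1, tn). *)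
Definition polygon_length (c : R -> X) (s : R) (p : seq R) : R :=
  \sum_(uv <- zip (s :: p) p) mdist (c uv.1) (c uv.2).

Definition sub_length (c : R -> X) (s t : R) : \bar R :=
  ereal_sup [set (polygon_length c s p)%:E | p in itv_partition s t].

Definition curve_length (c : curve) : \bar R :=
  sub_length c (curve_start c) (curve_stop c).

Definition rectifiable (c : curve) := (curve_length c < +oo)%E.

Definition nonconstant (c : curve) :=
  exists s t, [/\ s \in `[curve_start c, curve_stop c],
    t \in `[curve_start c, curve_stop c] & c s <> c t].

(* The distribution function of s_c: t |-> length of c restricted to
   [curve_start, t], extended by constants outside the domain of c
   (and by 0 when c is not rectifiable). *)
Definition arclength (c : curve) (t : R) : R :=
  if (curve_length c < +oo)%E then
    fine (sub_length c (curve_start c)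
      (Num.min (Num.max (curve_start c) t) (curve_stop c)))
  else 0.

End curves.

Section sub_length_theory.
Context (R : realType) (X : metricType R).
Implicit Types (c : R -> X) (s t u a b : R).

Lemma polygon_length_cons c s u p :
  polygon_length c s (u :: p) = mdist (c s) (c u) + polygon_length c u p.
Proof. by rewrite /polygon_length /= big_cons. Qed.

Lemma polygon_length_cat c s p q : polygon_length c s (p ++ q) =
  polygon_length c s p + polygon_length c (last s p) q.
Proof.
elim: p s => [|x p ih] s; first by rewrite /polygon_length /= big_nil add0r.
by rewrite /= !polygon_length_cons ih addrA.
Qed.

Lemma polygon_length_le c s t p : itv_partition s t p ->
  ((polygon_length c s p)%:E <= sub_length c s t)%E.
Proof. by move=> pst; apply: ereal_sup_ubound; exists p. Qed.

Lemma mdist_le_sub_length c s t : s <= t ->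
  ((mdist (c s) (c t))%:E <= sub_length c s t)%E.
Proof.
rewrite le_eqVlt => /orP[/eqP ->|st].
  rewrite metric_structure.mdistxx.
  have /(polygon_length_le c) : itv_partition t t [::] by split.
  by rewrite /polygon_length big_nil.
have /(polygon_length_le c) := itv_partition1 st.
by rewrite polygon_length_cons /polygon_length big_nil addr0.
Qed.

Lemma sub_length_ge0 c s t : s <= t -> (0 <= sub_length c s t)%E.
Proof.
move=> st; apply: le_trans (mdist_le_sub_length c st).
by rewrite lee_fin mdist_ge0.
Qed.

Lemma sub_lengthxx c s : sub_length c s s = 0%E.
Proof.
apply/eqP; rewrite eq_le sub_length_ge0 ?andbT//.
apply: ge_ereal_sup => _ [p /itv_partitionxx -> <-].
by rewrite /polygon_length big_nil.
Qed.

Lemma sub_length_split_le c s u t : s <= u -> u <= t ->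
  (sub_length c s t <= sub_length c s u + sub_length c u t)%E.
Proof.
move=> su ut; apply: ge_ereal_sup => _ [p pst <-].
elim: p s su pst => [|x p ih] s su pst.
  rewrite /polygon_length big_nil.
  by rewrite adde_ge0// sub_length_ge0.
have sx : s < x by case: pst => /= /andP[].
have pxt := itv_partition_cons pst.
rewrite polygon_length_cons EFinD.
have [xu|ux] := leP x u.
  apply: (@le_trans _ _ ((mdist (c s) (c x))%:E +
      (sub_length c x u + sub_length c u t))%E).
    by rewrite leeD2l// ih.
  rewrite addeA leeD2r//.
  have mE q : itv_partition x u q ->
      ((mdist (c s) (c x))%:E + (polygon_length c x q)%:E <= sub_length c s u)%E.
    move=> qxu; rewrite -EFinD -polygon_length_cons; apply: polygon_length_le.
    by case: qxu => xq lq; split => //=; rewrite sx.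
  rewrite -leeBrDl//; apply: ge_ereal_sup => _ [q qxu <-].
  by rewrite leeBrDl// mE.
have qut : itv_partition u t (x :: p).
  by case: pxt => xp lp; split => //=; rewrite ux.
apply: (@le_trans _ _ ((mdist (c s) (c u))%:E +
    (polygon_length c u (x :: p))%:E)%E).
  rewrite polygon_length_cons -!EFinD lee_fin addrA lerD2r.
  exact: metric_triangle.
by apply: leeD; [exact: mdist_le_sub_length|exact: polygon_length_le].
Qed.

Lemma sub_length_le_left c s u t : s <= u ->
  (sub_length c u t <= sub_length c s t)%E.
Proof.
rewrite le_eqVlt => /orP[/eqP ->//|su].
apply: ge_ereal_sup => _ [q qut <-].
apply: (@le_trans _ _ ((polygon_length c s (u :: q))%:E)).
  by rewrite polygon_length_cons lee_fin lerDr mdist_ge0.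
apply: polygon_length_le.
exact: (itv_partition_cat (itv_partition1 su) qut).
Qed.

Lemma sub_length_split_ge c s u t : s <= u -> u <= t ->
  (sub_length c s u + sub_length c u t <= sub_length c s t)%E.
Proof.
move=> su ut.
have [->|fst] := eqVneq (sub_length c s t) +oo%E; first by rewrite leey.
have st := le_trans su ut.
have f : sub_length c s t \is a fin_num.
  by rewrite ge0_fin_numE ?sub_length_ge0// ltey.
rewrite -leeBrDr//; last first.
  rewrite ge0_fin_numE ?sub_length_ge0//.
  by apply: le_lt_trans (sub_length_le_left c t su) _; rewrite ltey.
apply: ge_ereal_sup => _ [p psu <-].
rewrite leeBrDr; last first.
  rewrite ge0_fin_numE ?sub_length_ge0//.
  by apply: le_lt_trans (sub_length_le_left c t su) _; rewrite ltey.
rewrite -leeBrDl//; apply: ge_ereal_sup => _ [q qut <-].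
rewrite leeBrDl// -EFinD.
have := polygon_length_le c (itv_partition_cat psu qut).
by rewrite polygon_length_cat; case: psu => _ /eqP ->.
Qed.

Lemma sub_length_split c s u t : s <= u -> u <= t ->
  (sub_length c s t = sub_length c s u + sub_length c u t)%E.
Proof.
move=> su ut; apply/eqP; rewrite eq_le.
by rewrite sub_length_split_le// sub_length_split_ge.
Qed.

Lemma le_sub_length c a s t b : a <= s -> s <= t -> t <= b ->
  (sub_length c s t <= sub_length c a b)%E.
Proof.
move=> as_ st tb.
rewrite (@sub_length_split c a s b)//; last exact: le_trans tb.
rewrite (@sub_length_split c s t b)//.
rewrite addeCA leeDl// adde_ge0// sub_length_ge0//.
Qed.

Lemma sub_length_small_right c s b e : s < b ->
  (sub_length c s b < +oo)%E -> 0 < e ->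
  exists2 t, s < t & forall u, s < u -> u < t ->
    (sub_length c s u <= (mdist (c s) (c u) + e)%:E)%E.
Proof.
move=> sb fin e0.
have f : sub_length c s b \is a fin_num.
  by rewrite ge0_fin_numE// sub_length_ge0// ltW.
have [_ [p psb <-]] := ub_ereal_sup_adherent e0 f.
case: p psb => [/itv_partition_nil sE|t p pst lt1].
  by move: sb; rewrite sE ltxx.
have [/= /andP[st tp] lp] := pst.
have tb : t <= b := itv_partition_le (itv_partition_cons pst).
exists t => // u su ut.
have ub : u <= b := le_trans (ltW ut) tb.
have fu : sub_length c u b \is a fin_num.
  rewrite ge0_fin_numE ?sub_length_ge0//; apply: le_lt_trans fin.
  by rewrite le_sub_length// ltW.
have : (sub_length c s b - e%:E <= (mdist (c s) (c u))%:E + sub_length c u b)%E.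
  apply: le_trans (ltW lt1) _.
  apply: (@le_trans _ _ ((mdist (c s) (c u))%:E +
    (polygon_length c u (t :: p))%:E)%E).
    rewrite !polygon_length_cons -EFinD lee_fin addrA lerD2r.
    exact: metric_triangle.
  rewrite leeD2l//; apply: polygon_length_le; split => //=.
  by rewrite ut.
rewrite (sub_length_split _ (ltW su) ub).
have fsu : sub_length c s u \is a fin_num.
  rewrite ge0_fin_numE ?sub_length_ge0 ?ltW//; apply: le_lt_trans fin.
  by rewrite le_sub_length// ltW.
rewrite -(fineK fu) -(fineK fsu) -!EFinD !lee_fin.
set m := mdist _ _; set x := fine _; set y := fine _; lra.
Qed.

Lemma sub_length_small_left c a t e : a < t ->
  (sub_length c a t < +oo)%E -> 0 < e ->
  exists2 s, s < t & forall u, s < u -> u < t ->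
    (sub_length c u t <= (mdist (c u) (c t) + e)%:E)%E.
Proof.
move=> at_ fin e0.
have f : sub_length c a t \is a fin_num.
  by rewrite ge0_fin_numE// sub_length_ge0// ltW.
have [_ [p pat <-]] := ub_ereal_sup_adherent e0 f.
case/lastP: p pat => [/itv_partition_nil aE|p x pat lt1].
  by move: at_; rewrite aE ltxx.
have [] := pat; rewrite rcons_path last_rcons => /andP[ap px] /eqP xt.
subst x.
exists (last a p) => // u su ut.
have aup : itv_partition a u (rcons p u).
  by split; rewrite ?rcons_path ?last_rcons// ap.
have au : a <= u := itv_partition_le aup.
have fsu : sub_length c a u \is a fin_num.
  rewrite ge0_fin_numE ?sub_length_ge0//; apply: le_lt_trans fin.
  by rewrite le_sub_length// ltW.
have fu : sub_length c u t \is a fin_num.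
  rewrite ge0_fin_numE ?sub_length_ge0 ?(ltW ut)//; apply: le_lt_trans fin.
  by rewrite le_sub_length// ltW.
have : (sub_length c a t - e%:E <= sub_length c a u + (mdist (c u) (c t))%:E)%E.
  apply: le_trans (ltW lt1) _.
  apply: (@le_trans _ _ ((polygon_length c a (rcons p u))%:E +
     (mdist (c u) (c t))%:E)%E); last by rewrite leeD2r// polygon_length_le.
  rewrite -!cats1 !polygon_length_cat !polygon_length_cons.
  rewrite /polygon_length !big_nil !addr0 -EFinD lee_fin -addrA lerD2l.
  exact: metric_triangle.
rewrite (sub_length_split _ au (ltW ut)).
rewrite -(fineK fu) -(fineK fsu) -!EFinD !lee_fin.
set m := mdist _ _; set x := fine _; set y := fine _; lra.
Qed.

End sub_length_theory.

Section arclength_measure.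
Context (R : realType) (X : metricType R) (c : curve X).
Local Notation a := (curve_start c).
Local Notation b := (curve_stop c).

Let curve_near x e : a <= x -> x <= b -> 0 < e ->
  \forall u \near x, a <= u -> u <= b -> mdist (c x) (c u) < e.
Proof.
move=> ax xb e0.
have /subspace_continuousP/(_ x) := @curve_continuous R X c.
rewrite /= in_itv/= ax xb => /(_ isT).
move=> /(_ (ball (c x) e)) /(_ (nbhsx_ballx _ _ e0)).
rewrite ballEmdist /= /nbhs /= /within/=.
by apply: filterS => u h au ub; apply: h; rewrite /= in_itv/= au ub.
Qed.

Let sub_fin s t : rectifiable c -> a <= s -> s <= t -> t <= b ->
  sub_length c s t \is a fin_num.
Proof.
move=> rc as_ st tb; rewrite ge0_fin_numE ?sub_length_ge0//.
exact: le_lt_trans (le_sub_length c as_ st tb) rc.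
Qed.

Let arclength_in t : rectifiable c -> a <= t -> t <= b ->
  (arclength c t)%:E = sub_length c a t.
Proof.
move=> rc at_ tb; rewrite /arclength [X in if X then _ else _](_ : _ = true)//.
by rewrite (max_idPr at_) (min_idPl tb) fineK// sub_fin.
Qed.

Let arclength_lt t : t <= a -> arclength c t = 0.
Proof.
move=> ta; rewrite /arclength; case: ifPn => // _.
by rewrite (max_idPl ta) (min_idPl (ltW (curve_lt c))) sub_lengthxx.
Qed.

Let arclength_gt t : b <= t -> arclength c t = arclength c b.
Proof.
move=> bt; rewrite /arclength; case: ifPn => // _.
have ab := ltW (curve_lt c).
by rewrite (max_idPr (le_trans ab bt)) (max_idPr ab) (min_idPr bt) minxx.
Qed.

Let arclength_nrc t : ~ rectifiable c -> arclength c t = 0.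
Proof. by move=> /negP rc; rewrite /arclength ifN. Qed.

Lemma arclengthB s t : rectifiable c -> a <= s -> s <= t -> t <= b ->
  (arclength c t - arclength c s)%:E = sub_length c s t.
Proof.
move=> rc as_ st tb; rewrite EFinB !arclength_in//; last 2 first.
- exact: le_trans tb.
- exact: le_trans st.
have f : sub_length c a s \is a fin_num by rewrite sub_fin// (le_trans st).
by rewrite (sub_length_split c as_ st) addeAC subee// add0e.
Qed.

Let arclength_nd : nondecreasing (arclength c).
Proof.
move=> s t st; have ab := ltW (curve_lt c).
have [rc|/arclength_nrc nrc] := pselect (rectifiable c); last by rewrite !nrc.
have nd x y : a <= x -> x <= y -> y <= b -> arclength c x <= arclength c y.
  by move=> ax xy yb; rewrite -subr_ge0 -lee_fin arclengthB// sub_length_ge0.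
have [sa|/ltW as_] := leP s a.
  rewrite (arclength_lt sa) -(arclength_lt (lexx a)).
  have [ta|/ltW at_] := leP t a; first by rewrite (arclength_lt ta) arclength_lt.
  have [tb|/ltW bt] := leP t b; first exact: nd.
  by rewrite (arclength_gt bt) nd.
have [bs|/ltW sb] := leP b s.
  by rewrite (arclength_gt bs) (arclength_gt (le_trans bs st)).
have [tb|/ltW bt] := leP t b; first exact: nd.
by rewrite (arclength_gt bt) nd.
Qed.

Let arclength_rc : right_continuous (arclength c).
Proof.
move=> x; have ab := ltW (curve_lt c).
have [rc|/arclength_nrc nrc] := pselect (rectifiable c); last first.
  by rewrite (_ : arclength c = cst 0); [exact: cvg_cst|apply/funext].
have [xa|ax] := ltP x a.
  apply: cvg_near_cst; near=> u; apply/eqP.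
  rewrite (arclength_lt (ltW xa)) arclength_lt//.
  by near: u; exact: nbhs_right_le.
have [bx|xb] := leP b x.
  apply: cvg_near_cst; near=> u; apply/eqP.
  by rewrite (arclength_gt bx) arclength_gt// (le_trans bx).
apply/(@cvgrPdist_le _ R^o) => e e0; have e20 : 0 < e / 2 by rewrite divr_gt0.
have [t xt ht] := sub_length_small_right xb
  (le_lt_trans (le_sub_length c ax (ltW xb) (lexx b)) rc) e20.
have near_x : \forall u \near x^'+,
    a <= u -> u <= b -> mdist (c x) (c u) < e / 2.
  by apply: cvg_within; exact: (curve_near ax (ltW xb)).
near=> u.
have xu : x < u by near: u; exact: nbhs_right_gt.
have ub : u <= b by near: u; exact: nbhs_right_le.
have ut : u < t by near: u; exact: nbhs_right_lt.
have d : mdist (c x) (c u) < e / 2.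
  suff : a <= u -> u <= b -> mdist (c x) (c u) < e / 2.
    by apply => //; exact: le_trans (ltW xu).
  by near: u.
rewrite distrC ger0_norm ?subr_ge0 ?arclength_nd ?(ltW xu)//.
rewrite -lee_fin arclengthB ?(ltW xu)//.
apply: le_trans (ht u xu ut) _; rewrite lee_fin; lra.
Unshelve. all: by end_near. Qed.

HB.instance Definition _ :=
  isCumulative.Build R _ R (arclength c) arclength_nd arclength_rc.

Definition arclength_measure : {measure set (measurableTypeR R) -> \bar R} :=
  lebesgue_stieltjes_measure (arclength c).

Let arclength_measure_oc (s t : R) : s <= t ->
  arclength_measure `]s, t]%classic = (arclength c t - arclength c s)%:E.
Proof.
move=> st; rewrite /arclength_measure/= /lebesgue_stieltjes_measure/= /measure_extension/=.
by rewrite measurable_mu_extE/= ?wlength_itv_bnd//; exact: is_ocitv.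
Qed.

Let arclength_measure_set1 s : rectifiable c -> a <= s -> s <= b ->
  arclength_measure [set s] = 0%E.
Proof.
move=> rc as_ sb; apply/eqP; rewrite eq_le measure_ge0 andbT.
have sub u : u < s ->
    (arclength_measure [set s] <= (arclength c s - arclength c u)%:E)%E.
  move=> us; rewrite -(arclength_measure_oc (ltW us)) le_measure ?inE//.
  by move=> _ ->/=; rewrite in_itv/= us lexx.
move: as_; rewrite [a <= s]le_eqVlt => /orP[/eqP aE|as_].
  apply: le_trans (sub (a - 1) _) _; first by rewrite -aE ltrBlDr ltrDl.
  by rewrite -aE !arclength_lt ?subrr// lerBlDr lerDl.
apply/lee_addgt0Pr => e e0; rewrite add0e.
have e20 : 0 < e / 2 by rewrite divr_gt0.
have [t ts ht] := sub_length_small_left as_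
  (le_lt_trans (le_sub_length c (lexx a) (ltW as_) sb) rc) e20.
have near_s : \forall u \near s^'-,
    a <= u -> u <= b -> mdist (c s) (c u) < e / 2.
  by apply: cvg_within; exact: (curve_near (ltW as_)).
suff [u [us tu au]] : exists u, [/\ u < s, t < u & a < u /\
    (a <= u -> u <= b -> mdist (c s) (c u) < e / 2)].
  case: au => au /(_ (ltW au) (ltW (lt_le_trans us sb))) d.
  apply: le_trans (sub u us) _; rewrite arclengthB ?(ltW us) ?(ltW au)//.
  apply: le_trans (ht u tu us) _.
  by rewrite metric_sym lee_fin; lra.
near s^'- => u; exists u; split; [| |split].
- by near: u; exact: nbhs_left_lt.
- by near: u; exact: nbhs_left_gt.
- by near: u; exact: nbhs_left_gt.
- by near: u.
Unshelve. all: by end_near. Qed.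

(* The characterization of s_c: on subintervals of its domain it is the length
   of the restriction of c. *)
Lemma arclength_measureE s t : rectifiable c -> a <= s -> s <= t -> t <= b ->
  arclength_measure `[s, t]%classic = sub_length c s t.
Proof.
move=> rc as_ st tb.
rewrite -(setU1itv false) ?bnd_simp//.
transitivity (arclength_measure [set s] + arclength_measure `]s, t]%classic)%E.
  apply: measureU => //.
  by apply/seteqP; split => // x [/= ->]; rewrite in_itv/= ltxx.
rewrite arclength_measure_set1//; last exact: le_trans tb.
by rewrite add0e arclength_measure_oc// arclengthB.
Qed.

End arclength_measure.

Section modulus.
Context (R : realType) (X : completeMetricType R).
Local Open Scope ereal_scope.

Definition line_integral (c : curve X) (rho : X -> \bar R) : \bar R :=
  if curve_length c < +oo then
    \int[arclength_measure c]_(t in `[curve_start c, curve_stop c]) rho (c t)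
  else +oo.

Definition nonneg_borel (rho : borelType X -> \bar R) :=
  measurable_fun setT rho /\ forall x, 0 <= rho x.

Context (m : {measure set (borelType X) -> \bar R}) (p : R).

Definition Mod (Gamma : set (curve X)) : \bar R :=
  ereal_inf [set \int[m]_x (rho x `^ p) | rho in
    [set rho | nonneg_borel rho /\
      forall c, Gamma c -> 1 <= line_integral c rho]].

(* The exceptional family consists of all nonconstant rectifiable curves along
   which the inequality, or the finiteness of f at an endpoint, fails. *)
Definition WUG (f : X -> \bar R) : set (X -> \bar R) :=
  [set rho | [/\ nonneg_borel rho, \int[m]_x (rho x `^ p) < +oo &
    Mod [set c | [/\ rectifiable c, nonconstant c &
      ~ [/\ f (c (curve_start c)) \is a fin_num,
            f (c (curve_stop c)) \is a fin_num &
            `|f (c (curve_stop c)) - f (c (curve_start c))|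
              <= line_integral c rho]]] = 0]].

Definition minimal_WUG (f : X -> \bar R) : set (X -> \bar R) :=
  [set rho | WUG f rho /\
    forall rho', WUG f rho' -> 'N[m]_p%:E[rho] <= 'N[m]_p%:E[rho']].

End modulus.

Definition lip (R : realType) (phi : R -> R) (t : R) : \bar R :=
  lime_sup (fun s => (`|phi s - phi t| / `|s - t|)%:E) t.

(* Main.v *)
Require Import Defs.
From HB Require Import structures.
From mathcomp Require Import all_boot all_order all_algebra.
From mathcomp Require Import all_classical all_reals all_analysis measurable_realfun.
From mathcomp Require Import lra.
Set Implicit Arguments.
Unset Strict Implicit.
Unset Printing Implicit Defensive.
Import Order.TTheory GRing.Theory Num.Theory.
Import numFieldNormedType.Exports.
Local Open Scope classical_set_scope.
Local Open Scope ring_scope.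
Local Open Scope ereal_scope.

(** Along a curve c with arclength measure s, a weak upper gradient rho of f is a
density that dominates the increments of f o c: for almost every nonconstant
curve, f o c is finite everywhere and |f(c(t)) - f(c(s))| is at most the integral of rho o c over
]s, t] for all s <= t ([WUG_along]). So every assertion reduces to calculus on an
interval, with one tool, [frozen_coefficients_le_integral]: if near each t the
increments |k(u) - k(t)| are at most (w(t) + e) times the integral of r between t
and u, for every e > 0, then the total increment of k is at most the integral of
w r. Its proof replaces w by a slightly larger function that exceeds w(t) near
each t (Vitali-Caratheodory) and then extends the local inequality to the
interval by a supremum argument. [WUG_frozen_coefficients] is the resulting
criterion for weak upper gradients on X.

Taking coefficients 0 and 1, two weak upper gradients of f can be pasted along a
Borel set ([WUG_paste]); in particular their pointwise minimum is a weak upper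
gradient, so a minimal one is below every other almost everywhere
([minimal_WUG_le]). It remains to exhibit weak upper gradients.

Null values. For a null set N of reals, compose f with a function that is
uniformly close to the identity and locally constant near N. Along a curve the
composition has no increments where f takes its values in N, so rho may be set
to 0 there ([WUG_drop_null_values]). Almost no nonconstant curve meets the
infinite values at all. This gives the vanishing of rho_f, and it gives locality because
f - g has the single value 0 on the set where f = g.

Chain rule. A Lipschitz function is differentiable off a null set N
([lipschitz_ae_is_derive]), by the Radon-Nikodym and Lebesgue differentiation
theorems, and lip(phi) = |phi'| off N; values in N have just been discarded. The
increments of phi o f are |phi'(f)| times those of f, which makes |phi'(f)| rho_f
a weak upper gradient of phi o f; read backwards where |phi'(f)| >= 1/(n+1), this
makes rho_g / |phi'(f)|, pasted with rho_f, a weak upper gradient of f.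

Leibniz rule. The frozen estimate for f g is the usual expansion of the increment
of a product. That |f| + |g| <= C holds only almost everywhere in X, but a
function which has a weak upper gradient and vanishes almost everywhere vanishes
along almost every nonconstant curve ([WUG_ae_zero]); applied to the positive
part of |f| + |g| - C, this bounds f and g on the curves. *)

(** * Regularity of finite measures on the line *)

Section outer_regularity.
Context (R : realType) (mu : {measure set (measurableTypeR R) -> \bar R}).
Hypothesis muT : mu setT < +oo.

Let squeezed (A : set R) := forall e : R, (0 < e)%R ->
  exists U F : set R, [/\ open U, closed F, F `<=` A, A `<=` U &
    mu (U `\` F) < e%:E].

Let mopen (U : set R) : open U -> measurable (U : set (measurableTypeR R)).
Proof. exact: open_measurable. Qed.

Let mclosed (F : set R) : closed F -> measurable (F : set (measurableTypeR R)).
Proof. exact: closed_measurable. Qed.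

Let mu_lty (A : set (measurableTypeR R)) : measurable A -> mu A < +oo.
Proof.
by move=> mA; apply: le_lt_trans muT; apply: le_measure; rewrite ?inE.
Qed.

Let squeezed_ray (x : R) : squeezed `]x, +oo[%classic.
Proof.
move=> e e0.
pose B (n : nat) : set (measurableTypeR R) := `]x, (x + n.+1%:R^-1)%R[%classic.
have B0 : \bigcap_n B n = set0.
  apply/seteqP; split => // y By; have := By 0%N I.
  rewrite /B/= in_itv/= => /andP[xy _].
  have [n yn] : exists n : nat, (n.+1%:R^-1 < y - x)%R.
    have yx0 : (0 < y - x)%R by rewrite subr_gt0.
    near \oo => n; exists n; near: n; exact: near_infty_natSinv_lt (PosNum yx0).
  have := By n I; rewrite /B/= in_itv/= => /andP[_]; rewrite -ltrBlDl.
  by move/(lt_trans yn); rewrite ltxx.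
have : mu \o B @ \oo --> mu (\bigcap_n B n).
  apply: nonincreasing_cvg_mu.
  - by apply: mu_lty; exact: measurable_itv.
  - by move=> i; exact: measurable_itv.
  - by rewrite B0; exact: measurable0.
  - move=> m n mn; apply/subsetPset => y; rewrite /B/= !in_itv/= => /andP[-> yn]/=.
    by apply: (lt_le_trans yn); rewrite lerD2l lef_pV2 ?posrE// ler_nat.
rewrite B0 measure0 => cvB.
have /fine_cvgP[_ /cvgrPdist_lt/(_ e e0)] := cvB.
move=> [n _ /(_ n (leqnn n))]; rewrite /= sub0r normrN => Bn.
exists `]x, +oo[%classic, `[(x + n.+1%:R^-1)%R, +oo[%classic; split.
- exact: interval_open.
- exact: interval_closed.
- move=> y; rewrite /= !in_itv/= !andbT; apply: lt_le_trans.
  by rewrite ltrDl invr_gt0.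
- by [].
- rewrite (_ : _ `\` _ = B n).
    have Bf : mu (B n) \is a fin_num.
      by rewrite ge0_fin_numE// mu_lty//; exact: measurable_itv.
    rewrite -(fineK Bf) lte_fin; apply: le_lt_trans Bn; exact: ler_norm.
  apply/seteqP; split => y; rewrite /B /= !in_itv/= !andbT.
    by move=> [-> /negP]; rewrite -ltNge.
  by move=> /andP[-> h]; split => //; apply/negP; rewrite -ltNge.
Unshelve. all: by end_near. Qed.

Let squeezedC (A : set R) : squeezed A -> squeezed (~` A).
Proof.
move=> sA e /sA[U [F [oU cF FA AU UF]]]; exists (~` F), (~` U); split.
- exact: closed_openC.
- exact: open_closedC.
- exact: subsetC.
- exact: subsetC.
- by rewrite setDE setCK setIC -setDE.
Qed.

Let squeezed_bigcup (A : (set R)^nat) :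
  (forall n, squeezed (A n)) -> squeezed (\bigcup_n A n).
Proof.
move=> sA e e0.
have e2 n : (0 < e / 2 / 2 ^+ n.+1)%R by rewrite divr_gt0 ?divr_gt0// exprn_gt0.
have /choice[UF UFP] : forall n, exists UF : set R * set R,
    [/\ open UF.1, closed UF.2, UF.2 `<=` A n, A n `<=` UF.1 &
      mu (UF.1 `\` UF.2) < (e / 2 / 2 ^+ n.+1)%:E].
  by move=> n; have [U [F ?]] := sA n _ (e2 n); exists (U, F).
pose U := \bigcup_n (UF n).1.
(* Only a finite union of closed sets is closed: the tail is cut off by
   continuity from above. *)
pose F n := \big[setU/set0]_(i < n) (UF i).2.
pose D n : set (measurableTypeR R) := U `\` F n.
have mU : measurable (U : set (measurableTypeR R)).
  by apply: mopen; apply: bigcup_open => i _; case: (UFP i).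
have cF n : closed (F n).
  by apply: closed_bigsetU => i _; case: (UFP i).
have mD n : measurable (D n) by apply: measurableD => //; apply: mclosed.
have Dlim : \bigcap_n D n `<=` \bigcup_n ((UF n).1 `\` (UF n).2).
  move=> x Dx; have [[n _ Unx] _] := Dx 0%N I; exists n => //; split => // Fx.
  by have [_] := Dx n.+1 I; apply; rewrite /F big_ord_recr/=; right.
have mUF n : measurable ((UF n).1 `\` (UF n).2 : set (measurableTypeR R)).
  by apply: measurableD; [apply: mopen|apply: mclosed]; case: (UFP n).
have Dlt : mu (\bigcap_n D n) < e%:E.
  apply: (@le_lt_trans _ _ (e / 2)%:E); last first.
    by rewrite lte_fin ltr_pdivrMr// ltr_pMr// ltr1n.
  apply: (@le_trans _ _ (\sum_(n <oo) mu ((UF n).1 `\` (UF n).2))).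
    by apply: measure_sigma_subadditive => //; exact: bigcapT_measurable.
  apply: (@le_trans _ _ (\sum_(n <oo) (e / 2 / 2 ^+ n.+1)%:E)).
    by apply: lee_nneseries => // n _ ; case: (UFP n) => _ _ _ _ /ltW.
  have := @cvg_geometric_eseries_half R (e / 2) 0.
  rewrite expr0 divr1 => /cvg_lim <-//; apply: lee_nneseries => //.
  - by move=> n _ _; rewrite lee_fin ltW.
  - by move=> n _; rewrite addn1 natrX.
have : mu \o D @ \oo --> mu (\bigcap_n D n).
  apply: nonincreasing_cvg_mu => //.
  - exact: mu_lty.
  - exact: bigcapT_measurable.
  - move=> m n mn; apply/subsetPset; apply: setDS.
    exact: (@subset_bigsetU _ (fun i => (UF i).2)).
move=> cvD.
have Df : mu (\bigcap_n D n) \is a fin_num.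
  by rewrite ge0_fin_numE// mu_lty//; exact: bigcapT_measurable.
have ed : (0 < e - fine (mu (\bigcap_n D n)))%R.
  by rewrite subr_gt0 -lte_fin fineK.
rewrite -(fineK Df) in cvD.
have /fine_cvgP[_ /cvgrPdist_lt/(_ _ ed)] := cvD.
move=> [n _ /(_ n (leqnn n))]; rewrite /= distrC => Dn.
exists U, (F n); split => //.
- by apply: bigcup_open => i _; case: (UFP i).
- apply: (@subset_trans _ (\bigcup_n (UF n).2)); first exact: bigsetU_bigcup.
  by apply: subset_bigcup => i _; case: (UFP i).
- by apply: subset_bigcup => i _; case: (UFP i).
- have Dnf : mu (D n) \is a fin_num by rewrite ge0_fin_numE// mu_lty.
  rewrite -/(D n) -(fineK Dnf) lte_fin.
  have := le_lt_trans (ler_norm _) Dn; lra.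
Qed.

(** The sets that can be squeezed, up to small measure, between a closed and an
open set form a sigma-algebra containing the rays. *)
Lemma finite_measure_outer_regular (A : set (measurableTypeR R)) (e : R) :
  measurable A -> (0 < e)%R ->
  exists U : set R, [/\ open U, A `<=` U & mu (U `\` A) < e%:E].
Proof.
move=> mA e0.
have sq : squeezed A.
  have : (RGenOInfty.G (R := R)).-sigma.-measurable (A : set R).
    by rewrite -RGenOInfty.measurableE.
  apply: smallest_sub; last by move=> _ [x ->]; exact: squeezed_ray.
  split => //.
  - move=> d d0; exists set0, set0; split; [exact: open0|exact: closed0|by []|by []|].
    by rewrite setD0 measure0 lte_fin.
  - by move=> B sB; rewrite setTD; exact: squeezedC.
have [U [F [oU cF FA AU UF]]] := sq e e0.
exists U; split => //; apply: le_lt_trans UF.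
apply: le_measure; rewrite ?inE.
- by apply: measurableD => //; exact: mopen.
- by apply: measurableD; [exact: mopen|exact: mclosed].
- exact: setDS.
Qed.

End outer_regularity.

Section density.
Context (R : realType) (S : {measure set (measurableTypeR R) -> \bar R}).
Context (r : measurableTypeR R -> \bar R).
Hypotheses (mr : measurable_fun setT r) (r0 : forall x, 0 <= r x).

(** The hypotheses are arguments so that the measure structure can be inferred
from the term. *)
Definition density_measure of measurable_fun setT r & (forall x, 0 <= r x) :=
  fun A => \int[S]_(x in A) r x.

Let nu := density_measure mr r0.

Let nu0 : nu set0 = 0.
Proof. exact: integral_set0. Qed.

Let nu_ge0 A : 0 <= nu A.
Proof. by apply: integral_ge0 => x _. Qed.

Let nu_sigma_additive : semi_sigma_additive nu.
Proof. exact: semi_sigma_additive_nng_induced. Qed.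

HB.instance Definition _ := isMeasure.Build _ _ _ nu
  nu0 nu_ge0 nu_sigma_additive.

Lemma density_outer_regular (A : set (measurableTypeR R)) (e : R) :
  \int[S]_x r x < +oo -> measurable A -> (0 < e)%R ->
  exists U : set R, [/\ open U, A `<=` U & \int[S]_(x in U `\` A) r x < e%:E].
Proof.
move=> roo mA e0.
have nuT : [the {measure set (measurableTypeR R) -> \bar R} of nu] setT < +oo.
  exact: roo.
exact: (finite_measure_outer_regular nuT mA e0).
Qed.

End density.

Lemma integral_indicM d (T : measurableType d) (R : realType)
    (mu : {measure set T -> \bar R}) (A : set T) (f : T -> \bar R) :
  \int[mu]_x ((\1_A x)%:E * f x) = \int[mu]_(x in A) f x.
Proof.
rewrite [RHS]integral_mkcond; apply: eq_integral => x _.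
by rewrite patchE indicE; case: (x \in A); rewrite ?mul1e ?mul0e.
Qed.

(** The number of multiples of e below x counts x up to e; this discretizes a
bounded function into its superlevel sets. *)
Lemma staircase (R : realDomainType) (e x : R) (n : nat) :
  (0 <= e -> 0 <= x -> Num.min x (n%:R * e) <= \sum_(j < n) e * (j%:R * e <= x)%R%:R /\
  \sum_(j < n) e * (j%:R * e <= x)%R%:R <= Num.min (n%:R * e) (x + e))%R.
Proof.
move=> e0 x0; elim: n => [|n [ih1 ih2]].
  by rewrite big_ord0 mul0r min_r// min_l// addr_ge0.
rewrite big_ord_recr/=.
have nS : (n.+1%:R * e = n%:R * e + e)%R by rewrite -natr1 mulrDl mul1r.
rewrite !nS; move: ih1 ih2; set s := (\sum_(i < n) _)%R; set y := (n%:R * e)%R.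
have [yx|] := boolP (y <= x)%R; last rewrite -ltNge => xy; rewrite ?mulr1 ?mulr0.
  rewrite min_r// => ih1; rewrite min_l ?(le_trans yx) ?lerDl// => ih2.
  split; first by rewrite ge_min lerD2r ih1 orbT.
  by rewrite le_min !lerD2r ih2 (le_trans ih2).
rewrite addr0 min_l ?(ltW xy)// => ih1; rewrite !le_min => /andP[ih2 ih3].
by rewrite ge_min ih1 ih3 andbT; split => //; rewrite (le_trans ih2)// lerDl.
Qed.

(** * Increments bounded locally with frozen coefficients *)

Section vitali_caratheodory.
Context (R : realType) (S : {measure set (measurableTypeR R) -> \bar R}).
Context (r : measurableTypeR R -> \bar R) (w : measurableTypeR R -> R) (M : R).
Hypotheses (mr : measurable_fun setT r) (r0 : forall x, 0 <= r x).
Hypothesis (rfin : \int[S]_x r x < +oo).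
Hypotheses (mw : measurable_fun setT w) (w0 : forall x, (0 <= w x)%R).
Hypothesis (wM : forall x, (w x <= M)%R).

(** Vitali-Caratheodory: w is discretized into superlevel sets, which are then
enlarged to open sets at a small cost for the density r. Openness makes the
lower bound by w t persist near t. *)
Lemma vitali_caratheodory (h : R) : (0 < h)%R ->
  exists (v : measurableTypeR R -> R) (e : R),
    [/\ (0 < e)%R, measurable_fun setT v, forall x, (0 <= v x)%R,
        forall t : R, \forall u \near t, (w t + e <= v u)%R &
        \int[S]_x ((v x)%:E * r x) <= \int[S]_x ((w x)%:E * r x) + h%:E].
Proof.
move=> h0; set J := \int[S]_x r x.
have J0 : 0 <= J by apply: integral_ge0 => x _.
have Jf : J \is a fin_num by rewrite ge0_fin_numE.
pose i := fine J; have i0 : (0 <= i)%R by exact: fine_ge0.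
have i10 : (0 < i + 1)%R by rewrite ltr_wpDl.
(* The discretization costs 2 e times the integral of r, at most h / 2, and each
   of the n open sets costs e d, with n e d = h / 2. *)
pose e := (h / 4 / (i + 1))%R.
have e0 : (0 < e)%R by rewrite !divr_gt0.
pose n := (Num.bound (M / e)).+1.
have Mn : (M <= n%:R * e)%R.
  rewrite -ler_pdivrMr//; apply: le_trans (ler_norm _) _.
  apply: le_trans (ltW (archi_boundP _)) _ => //.
  by rewrite ler_nat leqW// /Num.bound normr_id.
pose W (j : nat) : set (measurableTypeR R) := [set x | (j%:R * e <= w x)%R].
have mW j : measurable (W j).
  rewrite /W; have := mw measurableT (measurable_itv `[(j%:R * e)%R, +oo[).
  rewrite setTI (_ : _ @^-1` _ = [set x | (j%:R * e <= w x)%R])//.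
  by apply/seteqP; split => x /=; rewrite in_itv/= andbT.
pose d := (h / 2 / (n%:R * e))%R.
have ne0 : (0 < n%:R * e)%R by rewrite mulr_gt0 ?ltr0n.
have d0 : (0 < d)%R by rewrite !divr_gt0.
have /choice[U UP] : forall j, exists U : set R, [/\ open U, W j `<=` U &
    \int[S]_(x in U `\` W j) r x < d%:E].
  by move=> j; apply: density_outer_regular.
have mU j : measurable (U j : set (measurableTypeR R)).
  by apply: open_measurable; case: (UP j).
pose v (x : measurableTypeR R) : R := (e + \sum_(j < n) e * \1_(U j) x)%R.
have sum0 (A : nat -> set (measurableTypeR R)) x :
    (0 <= \sum_(j < n) e * \1_(A j) x)%R.
  by apply: sumr_ge0 => j _; rewrite mulr_ge0// ltW.
have msum (A : nat -> set (measurableTypeR R)) : (forall j, measurable (A j)) ->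
    measurable_fun setT (fun x : measurableTypeR R => \sum_(j < n) e * \1_(A j) x)%R.
  move=> mA; apply: measurable_sum => j.
  by apply: measurable_funM => //; exact: measurable_indic.
have wW t : (w t <= \sum_(j < n) e * \1_(W j) t <= w t + e)%R.
  have [s1 s2] := staircase n (ltW e0) (w0 t).
  have E : (\sum_(j < n) e * \1_(W j) t =
            \sum_(j < n) e * (j%:R * e <= w t)%R%:R)%R.
    apply: eq_bigr => j _; congr (_ * _)%R; rewrite indicE.
    by congr ((_ : bool)%:R); apply/idP/idP; rewrite inE.
  rewrite E; apply/andP; split.
    by apply: le_trans s1; rewrite min_l// (le_trans (wM t)).
  by apply: le_trans s2 _; rewrite ge_min lexx orbT.
exists v, e; split => //.
- by apply: measurable_funD => //; exact: msum.
- by move=> x; rewrite addr_ge0// ltW.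
- move=> t.
  have tU : \forall u \near t, forall j : 'I_n, W j t -> U j u.
    apply: (@filter_forall R _ (fun j : 'I_n => [set u | W j t -> U j u])
      (nbhs (t : R)) _) => j.
    have [oU WU _] := UP j.
    have [Wt|Wt] := pselect (W j t); last by apply: nearW => u /Wt.
    have Ut : nbhs (t : R) (U j) by apply: open_nbhs_nbhs; split => //; exact: WU.
    by apply: filterS Ut => u Uu _.
  apply: filterS tU => u tU.
  rewrite addrC lerD2l; have /andP[+ _] := wW t; move/le_trans; apply.
  apply: ler_sum => j _; rewrite ler_pM2l// !indicE.
  have [tW|] := boolP (t \in W j); last by rewrite ler0n.
  suff -> : u \in U j by [].
  by rewrite inE; apply: tU; exact: set_mem.
- pose D j := U j `\` W j.
  have mD j : measurable (D j : set (measurableTypeR R)) by exact: measurableD.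
  have vle x : (v x <= w x + (e + e) + \sum_(j < n) e * \1_(D j) x)%R.
    have /andP[_ wWe] := wW x.
    suff : (\sum_(j < n) e * \1_(U j) x <=
            \sum_(j < n) e * \1_(W j) x + \sum_(j < n) e * \1_(D j) x)%R.
      by rewrite /v; move: wWe; set s1 := (\sum_(j < n) _)%R; lra.
    rewrite -big_split; apply: ler_sum => j _ /=.
    rewrite -mulrDr ler_pM2l// !indicE -natrD ler_nat.
    have [xU|] := boolP (x \in U j) => //.
    have [//|xW] := boolP (x \in W j).
    suff -> : x \in D j by [].
    by rewrite inE; split; [exact: set_mem|move/mem_set; exact/negP].
  have mI (A : set (measurableTypeR R)) : measurable A ->
      measurable_fun setT (fun x : measurableTypeR R => (\1_A x)%:E : \bar R).
    by move=> mA; apply: measurableT_comp => //; exact: measurable_indic.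
  have mwr : measurable_fun setT (fun x => (w x)%:E * r x).
    by apply: emeasurable_funM => //; exact/measurable_EFinP.
  have mDr j : measurable_fun setT (fun x : measurableTypeR R => e%:E * ((\1_(D j) x)%:E * r x)).
    apply: emeasurable_funM => //; apply: emeasurable_funM => //.
    exact: mI (mD j).
  have Dr0 j (x : measurableTypeR R) : 0 <= e%:E * ((\1_(D j) x)%:E * r x).
    by rewrite !mule_ge0 ?lee_fin// ltW.
  have ee0 : (0 <= e + e)%R by rewrite addr_ge0 ?ltW.
  apply: (@le_trans _ _ (\int[S]_x ((w x)%:E * r x + (e + e)%:E * r x +
      \sum_(j < n) (e%:E * ((\1_(D j) x)%:E * r x))))).
    apply: ge0_le_integral => //.
    + by move=> x _; rewrite mule_ge0// lee_fin addr_ge0// ltW.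
    + apply: emeasurable_funM => //; apply/measurable_EFinP.
      by apply: measurable_funD => //; exact: msum.
    + apply: emeasurable_funD; first by apply: emeasurable_funD => //; exact: emeasurable_funM.
      by apply: emeasurable_sum => j.
    + move=> x _.
      rewrite -ge0_muleDl ?lee_fin// -EFinD.
      under eq_bigr do rewrite muleA.
      rewrite -ge0_sume_distrl; last first.
        by move=> j _; rewrite -EFinM lee_fin mulr_ge0// ltW.
      rewrite -ge0_muleDl ?lee_fin ?addr_ge0 ?(ltW e0)//; last first.
        by apply: sume_ge0 => j _; rewrite -EFinM lee_fin mulr_ge0// ltW.
      apply: lee_wpmul2r => //.
      under eq_bigr do rewrite -EFinM.
      by rewrite sumEFin -EFinD lee_fin.
  rewrite ge0_integralD//; last 4 first.
  - by move=> x _; rewrite adde_ge0// mule_ge0// lee_fin.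
  - by apply: emeasurable_funD => //; exact: emeasurable_funM.
  - by move=> x _; apply: sume_ge0.
  - by apply: emeasurable_sum => j.
  rewrite ge0_integralD//; last 3 first.
  - by move=> x _; rewrite mule_ge0// lee_fin.
  - by move=> x _; rewrite mule_ge0// lee_fin.
  - exact: emeasurable_funM.
  rewrite -addeA leeD2l// ge0_integralZl//.
  rewrite ge0_integral_sum//.
  have Dd j : \int[S]_x (e%:E * ((\1_(D j) x)%:E * r x)) <= (e * d)%:E.
    rewrite ge0_integralZl//; last first.
    - by rewrite lee_fin ltW.
    - by move=> x _; rewrite mule_ge0// lee_fin.
    - by apply: emeasurable_funM => //; exact: mI.
    rewrite (EFinM e d); apply: lee_wpmul2l; first by rewrite lee_fin ltW.
    by rewrite integral_indicM ltW//; case: (UP j).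
  apply: (@le_trans _ _ ((e + e)%:E * i%:E + \sum_(j < n) (e * d)%:E)).
    by rewrite leeD// ?fineK// lee_sum.
  rewrite sumEFin -EFinM -EFinD lee_fin sumr_const card_ord -mulr_natl.
  have -> : (n%:R * (e * d) = h / 2)%R.
    by rewrite mulrA /d mulrC divfK// gt_eqF.
  have : (e * (i + 1) = h / 4)%R by rewrite /e divfK// gt_eqF.
  by move: e0 i0; rewrite mulrDr mulr1 mulrDl; set ei := (e * i)%R; lra.
Qed.
End vitali_caratheodory.

Definition between (R : realType) (t u : R) : set (measurableTypeR R) :=
  `]Num.min t u, Num.max t u]%classic.

Section local_to_global.
Context (R : realType) (S : {measure set (measurableTypeR R) -> \bar R}).
Implicit Types (x y z t u a b : R) (k : R -> R).

Lemma integral_itv_split (f : measurableTypeR R -> \bar R) x y z :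
  measurable_fun setT f -> (forall u, 0 <= f u) -> (x <= y)%R -> (y <= z)%R ->
  \int[S]_(u in `]x, z]) f u = \int[S]_(u in `]x, y]) f u + \int[S]_(u in `]y, z]) f u.
Proof.
move=> mf f0 xy yz.
have E : `]x, z]%classic = `]x, y]%classic `|` `]y, z]%classic.
  apply/seteqP; split => u /=; rewrite !in_itv/=.
    by move=> /andP[xu uz]; have [uy|yu] := leP u y; [left|right]; apply/andP.
  move=> [/andP[xu uy]|/andP[yu uz]]; apply/andP; split => //.
    exact: le_trans yz.
  exact: le_lt_trans yu.
rewrite E ge0_integral_setU//.
- exact: measurable_funTS.
- rewrite disj_set2E; apply/eqP/seteqP; split => // u [] /=; rewrite !in_itv/=.
  by move=> /andP[_ uy] /andP[/(le_lt_trans uy)]; rewrite ltxx.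
Qed.

Lemma between_lt t u : (t <= u)%R -> between t u = `]t, u]%classic.
Proof. by move=> tu; rewrite /between min_l// max_r. Qed.

Lemma between_gt t u : (u <= t)%R -> between t u = `]u, t]%classic.
Proof. by move=> tu; rewrite /between min_r// max_l. Qed.

Lemma measurable_between t u : measurable (between t u).
Proof. exact: measurable_itv. Qed.

Lemma between_sub t u a b : (a <= t <= b)%R -> (a <= u <= b)%R ->
  between t u `<=` `]a, b].
Proof.
move=> /andP[at_ tb] /andP[au ub] x; rewrite /between /= !in_itv/=.
move=> /andP[+ +]; rewrite gt_min le_max => h1 h2; apply/andP; split.
  by case/orP: h1; apply: le_lt_trans.
by case/orP: h2 => /le_trans; apply.
Qed.

Lemma between_ball t u x (d : R) : ball t d u -> between t u x -> ball t d x.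
Proof.
rewrite /ball/= /between /= in_itv/= !ltr_distlC => /andP[u1 u2].
move=> /andP[+ +]; rewrite gt_min le_max => h1 h2; apply/andP; split.
  by case/orP: h1 => h1; lra.
by case/orP: h2 => h2; lra.
Qed.

(** The set of endpoints up to which the estimate holds is closed under passing
to its supremum and, by the local hypothesis there, extends beyond it. *)
Lemma local_increment_le_integral (f : measurableTypeR R -> \bar R) k a b :
  measurable_fun setT f -> (forall u, 0 <= f u) -> (a <= b)%R ->
  (forall t, (a <= t <= b)%R -> \forall u \near t, (a <= u <= b)%R ->
    `|k u - k t|%:E <= \int[S]_(x in between t u) f x) ->
  `|k b - k a|%:E <= \int[S]_(x in `]a, b]) f x.
Proof.
move=> mf f0 ab loc.
pose E : set R := [set t | (a <= t <= b)%R /\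
  `|k t - k a|%:E <= \int[S]_(x in `]a, t]) f x].
have Ea : E a.
  by split; rewrite ?lexx// subrr normr0; apply: integral_ge0.
have supE : has_sup E by split; [exists a|exists b => t [/andP[]]].
pose s := sup E.
have as_ : (a <= s)%R by apply: ub_le_sup => //; case: supE.
have sb : (s <= b)%R by apply: ge_sup; [exists a|move=> t [/andP[]]].
have asb : (a <= s <= b)%R by rewrite as_ sb.
have /nbhs_ballP[d /= d0 sd] := loc s asb.
have step t u : E t -> (t <= u)%R -> (u <= b)%R ->
    `|k u - k t|%:E <= \int[S]_(x in between t u) f x -> E u.
  move=> [/andP[at_ tb] kt] tu ub ku; split.
    by rewrite ub (le_trans at_).
  rewrite (integral_itv_split mf f0 at_ tu) -(between_lt tu).
  apply: le_trans (leeD kt ku); rewrite -EFinD lee_fin.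
  apply: le_trans (ler_normD _ _).
  by rewrite [X in (_ <= `|X|)%R](_ : _ = k u - k a)%R//; lra.
have Es : E s.
  have [t Et st] := sup_adherent d0 supE.
  have ts : (t <= s)%R by apply: ub_le_sup => //; case: supE.
  apply: (step t s) => //.
  have -> : between t s = between s t by rewrite /between minC maxC.
  rewrite distrC; apply: sd.
    by rewrite /ball/= ger0_norm ?subr_ge0//; move: st; rewrite -/s; lra.
  by case: Et.
have [sb'|bs] := ltP s b; last first.
  by have <- : s = b by [apply/eqP; rewrite eq_le sb bs]; case: Es.
pose u := Num.min b (s + d / 2)%R.
have su : (s < u)%R by rewrite lt_min sb' ltrDl divr_gt0.
have : E u.
  apply: (step s u) => //; [exact: ltW|by rewrite ge_min lexx|].
  have ub : (u <= b)%R by rewrite ge_min lexx.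
  apply: sd; last by rewrite ub (le_trans as_)// ltW.
  rewrite /ball/= ler0_norm ?subr_le0 ?(ltW su)//.
  have : (u <= s + d / 2)%R by rewrite ge_min lexx orbT.
  by move: d0; lra.
by move=> /(ub_le_sup (proj2 supE)); rewrite leNgt su.
Qed.

(** The basic tool. Near t the frozen coefficients w1 t + e and w2 t + e are
below the Vitali-Caratheodory majorants v1 and v2, so the increments of k are
locally at most the integrals of v1 r1 + v2 r2. Two densities are needed to
glue two weak upper gradients and for the product rule. *)
Lemma frozen_coefficients_le_integral (r1 r2 : measurableTypeR R -> \bar R)
    (w1 w2 : measurableTypeR R -> R) (M : R) k a b :
  measurable_fun setT r1 -> (forall x, 0 <= r1 x) ->
  measurable_fun setT r2 -> (forall x, 0 <= r2 x) ->
  \int[S]_(x in `]a, b]) r1 x < +oo -> \int[S]_(x in `]a, b]) r2 x < +oo ->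
  measurable_fun setT w1 -> (forall x, 0 <= w1 x <= M)%R ->
  measurable_fun setT w2 -> (forall x, 0 <= w2 x <= M)%R ->
  (a <= b)%R ->
  (forall t (e : R), (a <= t <= b)%R -> (0 < e)%R ->
    \forall u \near t, (a <= u <= b)%R ->
      `|k u - k t|%:E <= (w1 t + e)%:E * \int[S]_(x in between t u) r1 x +
                         (w2 t + e)%:E * \int[S]_(x in between t u) r2 x) ->
  `|k b - k a|%:E <=
    \int[S]_(x in `]a, b]) ((w1 x)%:E * r1 x + (w2 x)%:E * r2 x).
Proof.
move=> mr1 r10 mr2 r20 r1oo r2oo mw1 w1M mw2 w2M ab loc.
set D : set (measurableTypeR R) := `]a, b]%classic.
have mD : measurable D by exact: measurable_itv.
have VC (r : measurableTypeR R -> \bar R) (w : measurableTypeR R -> R) h :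
    measurable_fun setT r -> (forall x, 0 <= r x) -> \int[S]_(x in D) r x < +oo ->
    measurable_fun setT w -> (forall x, 0 <= w x <= M)%R -> (0 < h)%R ->
  exists (v : measurableTypeR R -> R) (e : R),
    [/\ (0 < e)%R, measurable_fun setT v, forall x, (0 <= v x)%R,
        forall t : R, \forall u \near t, (w t + e <= v u)%R &
        \int[S]_(x in D) ((v x)%:E * r x) <= \int[S]_(x in D) ((w x)%:E * r x) + h%:E].
  move=> mr r0 roo mw wM h0.
  have mrD : measurable_fun setT (r \_ D).
    by apply: (measurable_restrictT _ mD).1; exact: measurable_funTS.
  have rD0 x : 0 <= (r \_ D) x by apply: erestrict_ge0.
  have rDoo : \int[S]_x (r \_ D) x < +oo by rewrite -integral_mkcond.
  have w0 x : (0 <= w x)%R by case/andP: (wM x).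
  have wM' x : (w x <= M)%R by case/andP: (wM x).
  have [v [e [e0 mv v0 lv iv]]] := vitali_caratheodory mrD rD0 rDoo mw w0 wM' h0.
  exists v, e; split => //.
  have ME g : (fun x => (g x)%:E * (r \_ D) x) = (fun x => (g x)%:E * r x) \_ D.
    by apply/funext => x; rewrite !patchE; case: ifP => //; rewrite mule0.
  by move: iv; rewrite !ME -!integral_mkcond.
apply/lee_addgt0Pr => h h0.
have h20 : (0 < h / 2)%R by rewrite divr_gt0.
have [v1 [e1 [e10 mv1 v10 lv1 iv1]]] := VC r1 w1 _ mr1 r10 r1oo mw1 w1M h20.
have [v2 [e2 [e20 mv2 v20 lv2 iv2]]] := VC r2 w2 _ mr2 r20 r2oo mw2 w2M h20.
have mM (g : measurableTypeR R -> R) (r : measurableTypeR R -> \bar R) :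
    measurable_fun setT g -> measurable_fun setT r ->
    measurable_fun setT (fun x => (g x)%:E * r x).
  by move=> mg mr; apply: emeasurable_funM => //; exact/measurable_EFinP.
have M0 (g : measurableTypeR R -> R) (r : measurableTypeR R -> \bar R) :
    (forall x, 0 <= g x)%R -> (forall x, 0 <= r x) ->
    forall x, 0 <= (g x)%:E * r x.
  by move=> g0 r0 x; rewrite mule_ge0// lee_fin.
have w10 x : (0 <= w1 x)%R by case/andP: (w1M x).
have w20 x : (0 <= w2 x)%R by case/andP: (w2M x).
have intD A (g1 g2 : measurableTypeR R -> R) : measurable A ->
    measurable_fun setT g1 -> (forall x, 0 <= g1 x)%R ->
    measurable_fun setT g2 -> (forall x, 0 <= g2 x)%R ->
    \int[S]_(x in A) ((g1 x)%:E * r1 x + (g2 x)%:E * r2 x) =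
    \int[S]_(x in A) ((g1 x)%:E * r1 x) + \int[S]_(x in A) ((g2 x)%:E * r2 x).
  move=> mA mg1 g10 mg2 g20; rewrite ge0_integralD//.
  - by move=> x _; exact: M0.
  - by apply: measurable_funTS; exact: mM.
  - by move=> x _; exact: M0.
  - by apply: measurable_funTS; exact: mM.
apply: (@le_trans _ _ (\int[S]_(x in D) ((v1 x)%:E * r1 x + (v2 x)%:E * r2 x))); last first.
  rewrite !intD//; apply: le_trans (leeD iv1 iv2) _.
  by rewrite addeACA -EFinD -splitr.
apply: local_increment_le_integral => //.
- by apply: emeasurable_funD; exact: mM.
- by move=> x; rewrite adde_ge0// M0.
move=> t atb.
pose e := Num.min e1 e2; have e0 : (0 < e)%R by rewrite lt_min e10.
have /nbhs_ballP[d1 /= d10 tv1] := lv1 t.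
have /nbhs_ballP[d2 /= d20 tv2] := lv2 t.
have Hd : \forall u \near t, ball t d1 u /\ ball t d2 u.
  by near=> u; split; near: u; exact: nbhsx_ballx.
apply: filterS2 (loc t e atb e0) Hd => u + [ud1 ud2] aub => /(_ aub) /le_trans; apply.
rewrite intD//; last exact: measurable_between.
have freeze (w v : measurableTypeR R -> R) (r : measurableTypeR R -> \bar R) (d e' : R) :
    (forall x, 0 <= w x)%R -> measurable_fun setT v ->
    measurable_fun setT r -> (forall x, 0 <= r x) -> (0 < e')%R -> (e <= e')%R ->
    ball t d u -> (forall x : R, ball t d x -> w t + e' <= v x)%R ->
    (w t + e)%:E * \int[S]_(x in between t u) r x <=
    \int[S]_(x in between t u) ((v x)%:E * r x).
  move=> w0 mv mr r0 e'0 ee' tdu wv.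
  have we0 : (0 <= w t + e)%R by rewrite addr_ge0// ltW.
  rewrite -ge0_integralZl//; last 2 first.
  - exact: measurable_between.
  - exact: measurable_funTS.
  apply: ge0_le_integral => //.
  - exact: measurable_between.
  - by move=> x _; rewrite mule_ge0.
  - by apply: emeasurable_funM => //; exact: measurable_funTS.
  - by apply: measurable_funTS; exact: mM.
  - move=> x /(between_ball tdu) /wv wvx; apply: lee_wpmul2r => //.
    by rewrite lee_fin (le_trans _ wvx)// lerD2l.
apply: leeD; [apply: (freeze w1 v1 r1 d1 e1)|apply: (freeze w2 v2 r2 d2 e2)] => //.
- by rewrite ge_min lexx.
- by rewrite ge_min lexx orbT.
Unshelve. all: by end_near. Qed.

End local_to_global.

(** * Curves and their subcurves *)

Section clamped_curves.
Context (R : realType).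
Implicit Types a b s t u : R.

Definition clamp a b t : R := Num.min (Num.max a t) b.

Lemma clamp_itv a b t : (a <= b)%R -> (a <= clamp a b t <= b)%R.
Proof. by move=> ab; rewrite /clamp le_min ab le_max lexx/= ge_min lexx orbT. Qed.

Lemma clamp_id a b t : (a <= t <= b)%R -> clamp a b t = t.
Proof. by move=> /andP[at_ tb]; rewrite /clamp max_r// min_l. Qed.

Lemma clamp_dist a b s t : (`|clamp a b s - clamp a b t| <= `|s - t|)%R.
Proof.
rewrite /clamp; have [as_|sa] := leP a s; have [at_|ta] := leP a t;
  [have [sb|bs] := leP s b; have [tb|bt] := leP t b
  |have [sb|bs] := leP s b; have [tb|bt] := leP a b
  |have [sb|bs] := leP a b; have [tb|bt] := leP t b
  |have [sb|bs] := leP a b];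
  rewrite ?subrr ?normr0 ?normr_ge0//;
  rewrite ler_norml; apply/andP; split;
  have := ler_norm (s - t)%R; have := ler_norm (t - s)%R;
  rewrite (distrC t s); lra.
Qed.

Context (X : completeMetricType R) (c : curve X).
Local Notation a := (curve_start c).
Local Notation b := (curve_stop c).

(** The values of a curve outside its interval are arbitrary; this extension by
constants is continuous, hence Borel, on the whole line. *)
Definition curve_ext (t : R) : X := c (clamp a b t).

Lemma curve_ext_id t : (a <= t <= b)%R -> curve_ext t = c t.
Proof. by move=> atb; rewrite /curve_ext clamp_id. Qed.

Lemma continuous_curve_ext : continuous curve_ext.
Proof.
move=> t; have ab := ltW (curve_lt c).
apply/cvg_ballP => e e0.
have /subspace_continuousP/(_ (clamp a b t)) := @curve_continuous R X c.
rewrite /= in_itv/= clamp_itv// => /(_ isT)/cvg_ballP/(_ e e0).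
rewrite /within/= => /nbhs_ballP[d /= d0 H].
apply/nbhs_ballP; exists d => // u tu; apply: H.
  exact: le_lt_trans (clamp_dist _ _ _ _) tu.
by rewrite /= in_itv/= clamp_itv.
Qed.

Lemma measurable_curve_ext :
  measurable_fun setT (curve_ext : measurableTypeR R -> borelType X).
Proof.
apply: (@measurability _ _ (measurableTypeR R) (borelType X) setT _ (@open X)) =>
  //= _ [U oU <-]; rewrite setTI; apply: open_measurable.
by apply: open_comp => // t _; exact: continuous_curve_ext.
Qed.

End clamped_curves.

Lemma measure_eq_within_oc (R : realType)
    (m1 m2 : {measure set (measurableTypeR R) -> \bar R}) (s t : R)
    (D := `]s, t]%classic : set (measurableTypeR R)) :
  m1 D < +oo ->
  (forall u v : R, m1 (`]u, v]%classic `&` D) = m2 (`]u, v]%classic `&` D)) ->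
  forall A : set (measurableTypeR R), measurable A -> A `<=` D -> m1 A = m2 A.
Proof.
move=> m1oo m12 A mA AD.
have mD : measurable D by exact: measurable_itv.
pose n1 : {measure set (measurableTypeR R) -> \bar R} := mrestr m1 mD.
pose n2 : {measure set (measurableTypeR R) -> \bar R} := mrestr m2 mD.
have : n1 A = n2 A.
  apply: (@measure_unique _ R (measurableTypeR R) (@ocitv R)
    (fun n => `](- n%:R)%R, n%:R]%classic) _ _ _ _ n1 n2) => //.
  - exact: ocitvI.
  - by move=> i; exact: is_ocitv.
  - rewrite -subTset => x _; exists (Num.bound `|x|%R) => //=.
    have := archi_boundP (normr_ge0 x); rewrite ltr_norml => /andP[h1 h2].
    by rewrite in_itv/= h1 ltW.
  - move=> B /ocitvP[->|[[u v] /= _ ->]]; last exact: m12.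
    by rewrite !measure0.
  - move=> k; apply: le_lt_trans m1oo.
    by apply: le_measure; rewrite ?inE//; exact: measurableI.
by rewrite /n1 /n2/= /mrestr !setIidl.
Qed.

Section arclength_of_subcurves.
Context (R : realType) (X : completeMetricType R) (c : curve X).
Hypothesis rc : rectifiable c.
Local Notation a := (curve_start c).
Local Notation b := (curve_stop c).
Local Notation S := (arclength_measure c).

Lemma arclength_measure_set1 s : (a <= s <= b)%R -> S [set s] = 0.
Proof.
move=> /andP[as_ sb].
have := arclength_measureE rc as_ (lexx s) sb.
by rewrite set_itv1 sub_lengthxx.
Qed.

Lemma arclength_measure_oc s t : (a <= s)%R -> (s <= t)%R -> (t <= b)%R ->
  S `]s, t]%classic = sub_length c s t.
Proof.
move=> as_ st tb; rewrite -(arclength_measureE rc as_ st tb).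
rewrite -(setU1itv false) ?bnd_simp//.
rewrite [RHS](@measureU _ _ _ S [set s] `]s, t]%classic)//.
- rewrite -[LHS]add0e; congr (_ + _); apply/esym/arclength_measure_set1.
  by rewrite as_ (le_trans st).
- by apply/seteqP; split => // x [/= ->]; rewrite in_itv/= ltxx.
Qed.

Lemma line_integral_oc (rho : borelType X -> \bar R) : nonneg_borel rho ->
  line_integral c rho = \int[S]_(t in `]a, b]) rho (curve_ext c t).
Proof.
move=> [mrho rho0]; rewrite /line_integral [X in if X then _ else _](_ : _ = true)//.
have ab := ltW (curve_lt c).
transitivity (\int[S]_(t in `[a, b]) rho (curve_ext c t)).
  by apply: eq_integral => t; rewrite inE/= in_itv/= => /curve_ext_id ->.
have mr : measurable_fun setT (fun t : measurableTypeR R => rho (curve_ext c t)).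
  exact: measurableT_comp mrho (measurable_curve_ext c).
rewrite -(setU1itv false) ?bnd_simp//.
rewrite ge0_integral_setU//.
- rewrite null_set_integral ?add0e//; first exact: measurable_funTS.
  by apply: arclength_measure_set1; rewrite lexx.
- exact: measurable_funTS.
- by rewrite disj_set2E; apply/eqP/seteqP; split => // x [/= ->]; rewrite in_itv/= ltxx.
Qed.

Lemma nonconstant_arclength_gt0 : nonconstant c -> 0 < S `]a, b]%classic.
Proof.
have ab := ltW (curve_lt c).
rewrite arclength_measure_oc// => -[s [t [sab tab cst]]].
wlog st : s t sab tab cst / (s <= t)%R.
  move=> W; have /orP[st|ts] := le_total s t; first exact: (W s t).
  by apply: (W t s) => //; apply: nesym.
move: sab tab; rewrite !in_itv/= => /andP[as_ sb] /andP[at_ tb].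
apply: lt_le_trans (le_sub_length c as_ st tb).
apply: lt_le_trans (mdist_le_sub_length c st).
rewrite lte_fin lt_neqAle mdist_ge0 andbT eq_sym.
by apply/eqP => /mdist_positivity.
Qed.

Section subcurve.
Context (s t : R) (as_ : (a <= s)%R) (st : (s < t)%R) (tb : (t <= b)%R).

Lemma subcurve_continuous : {within `[s, t], continuous c}.
Proof.
apply: continuous_subspaceW (@curve_continuous R X c) => u /=.
by rewrite !in_itv/= => /andP[su ut]; rewrite (le_trans as_ su) (le_trans ut tb).
Qed.

Definition subcurve : curve X := Curve st subcurve_continuous.

Lemma subcurve_rectifiable : rectifiable subcurve.
Proof.
apply: le_lt_trans rc; rewrite /curve_length/=.
by apply: le_sub_length => //; exact: ltW.
Qed.

End subcurve.
End arclength_of_subcurves.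

Section subcurve_integral.
Context (R : realType) (X : completeMetricType R) (c : curve X).
Hypothesis rc : rectifiable c.
Local Notation a := (curve_start c).
Local Notation b := (curve_stop c).
Context (s t : R) (as_ : (a <= s)%R) (st : (s < t)%R) (tb : (t <= b)%R).
Let c' := subcurve as_ st tb.
Let rc' : rectifiable c' := subcurve_rectifiable rc as_ st tb.

Let D : set (measurableTypeR R) := `]s, t]%classic.
Let mD : measurable D. Proof. exact: measurable_itv. Qed.

Let same_oc (u v : R) : arclength_measure c' (`]u, v]%classic `&` D) =
  arclength_measure c (`]u, v]%classic `&` D).
Proof.
have -> : `]u, v]%classic `&` D = `]Num.max u s, Num.min v t]%classic.
  apply/seteqP; split => x; rewrite /D /= !in_itv/= gt_max le_min.
    by move=> [/andP[-> ->] /andP[-> ->]].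
  by move=> /andP[/andP[-> ->] /andP[-> ->]].
have [uv|vu] := leP (Num.max u s) (Num.min v t); last first.
  rewrite set_itv_ge ?bnd_simp -?leNgt ?(ltW vu)//.
  by transitivity (0 : \bar R); [exact: measure0|exact/esym/measure0].
have su : (s <= Num.max u s)%R by rewrite le_max lexx orbT.
have vt : (Num.min v t <= t)%R by rewrite ge_min lexx orbT.
rewrite (arclength_measure_oc rc')// (arclength_measure_oc rc)//.
- exact: le_trans as_ _.
- exact: le_trans vt _.
Qed.

(** Both measures give a half-open interval the length of the curve over it. *)
Lemma subcurve_arclength (A : set (measurableTypeR R)) : measurable A ->
  A `<=` D -> arclength_measure c' A = arclength_measure c A.
Proof.
move=> mA AD.
apply: (@measure_eq_within_oc _ (arclength_measure c') (arclength_measure c)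
  s t _ same_oc A mA AD).
rewrite (arclength_measure_oc rc' (lexx _) (ltW st) (lexx _)).
exact: rc'.
Qed.

Lemma line_integral_subcurve (rho : borelType X -> \bar R) : nonneg_borel rho ->
  line_integral c' rho =
  \int[arclength_measure c]_(u in `]s, t]) rho (curve_ext c u).
Proof.
move=> nrho; rewrite (line_integral_oc rc' nrho).
rewrite (eq_measure_integral (arclength_measure c)); last first.
  exact: subcurve_arclength.
apply: eq_integral => u; rewrite inE/= in_itv/= => /andP[su ut].
rewrite clamp_id ?(ltW su)//.
by rewrite curve_ext_id// (le_trans as_ (ltW su)) (le_trans ut tb).
Qed.

End subcurve_integral.

(** * Properties of almost every curve *)

Lemma le_poweR (R : realType) (q : R) (x y : \bar R) : (0 <= q)%R ->
  0 <= x -> x <= y -> x `^ q <= y `^ q.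
Proof.
move=> q0 x0 xy; apply: gt0_ler_poweR => //.
- by rewrite in_itv/= x0 leey.
- by rewrite in_itv/= (le_trans x0 xy) leey.
Qed.

Section curve_almost_everywhere.
Context (R : realType) (X : completeMetricType R).
Context (m : {measure set (borelType X) -> \bar R}) (p : R) (p1 : (1 <= p)%R).
Implicit Types (rho sigma tau : borelType X -> \bar R) (c : curve X).

Let p0 : (0 < p)%R. Proof. exact: lt_le_trans p1. Qed.

Lemma nonneg_borelM (w : borelType X -> R) rho :
  measurable_fun setT w -> (forall x, 0 <= w x)%R -> nonneg_borel rho ->
  nonneg_borel (fun x => (w x)%:E * rho x).
Proof.
move=> mw w0 [mr r0]; split; last by move=> x; rewrite mule_ge0// lee_fin.
by apply: emeasurable_funM => //; exact/measurable_EFinP.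
Qed.

Lemma nonneg_borelD rho sigma : nonneg_borel rho -> nonneg_borel sigma ->
  nonneg_borel (fun x => rho x + sigma x).
Proof.
move=> [mr r0] [ms s0]; split; last by move=> x; rewrite adde_ge0.
exact: emeasurable_funD.
Qed.

Lemma nonneg_borel_maxe rho sigma : nonneg_borel rho -> nonneg_borel sigma ->
  nonneg_borel (fun x => maxe (rho x) (sigma x)).
Proof.
move=> [mr r0] [ms s0]; split; last by move=> x; rewrite le_max r0.
exact: measurable_maxe.
Qed.

Lemma measurable_poweR_comp rho : nonneg_borel rho ->
  measurable_fun setT (fun x => rho x `^ p).
Proof. by move=> [mr _]; exact: (measurableT_comp (measurable_poweR p) mr). Qed.

Definition finite_energy rho :=
  nonneg_borel rho /\ \int[m]_x (rho x `^ p) < +oo.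

Lemma finite_energy_le_maxe (k : R) rho sigma tau :
  nonneg_borel tau -> finite_energy rho -> finite_energy sigma ->
  (0 <= k)%R -> (forall x, tau x <= k%:E * maxe (rho x) (sigma x)) ->
  finite_energy tau.
Proof.
move=> ntau [nr rp] [ns sp] k0 tle; split => //.
have [mr r0] := nr; have [ms s0] := ns; have [mt t0] := ntau.
have mrp := measurable_poweR_comp nr; have msp := measurable_poweR_comp ns.
have kp0 : 0 <= k%:E `^ p by exact: poweR_ge0.
apply: (@le_lt_trans _ _ (\int[m]_x (k%:E `^ p * (rho x `^ p + sigma x `^ p)))).
  apply: ge0_le_integral => //.
  - by move=> x _; exact: poweR_ge0.
  - exact: measurable_poweR_comp.
  - apply: emeasurable_funM => //; exact: emeasurable_funD.
  move=> x _.
  apply: (@le_trans _ _ ((k%:E * maxe (rho x) (sigma x)) `^ p)).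
    by apply: le_poweR => //; exact: ltW.
  rewrite poweRM ?lee_fin ?le_max ?r0//.
  apply: lee_wpmul2l => //.
  by case: (leP (rho x) (sigma x)) => _; [rewrite leeDr|rewrite leeDl]; rewrite ?poweR_ge0.
rewrite ge0_integralZl//; last 2 first.
- exact: emeasurable_funD.
- by move=> x _; rewrite adde_ge0 ?poweR_ge0.
rewrite ge0_integralD//; try by move=> x _; exact: poweR_ge0.
by apply: lte_mul_pinfty => //; rewrite lte_add_pinfty.
Qed.

Lemma finite_energy_maxe rho sigma : finite_energy rho -> finite_energy sigma ->
  finite_energy (fun x => maxe (rho x) (sigma x)).
Proof.
move=> er es; apply: (finite_energy_le_maxe _ er es ler01).
  by apply: nonneg_borel_maxe; [case: er|case: es].
by move=> x; rewrite mul1e.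
Qed.

Lemma line_integral_lty c rho : line_integral c rho < +oo -> rectifiable c.
Proof. by rewrite /line_integral /rectifiable; case: ifPn => //. Qed.

Lemma measurable_along c rho : nonneg_borel rho ->
  measurable_fun setT (fun t : measurableTypeR R => rho (curve_ext c t)).
Proof. by move=> [mr _]; exact: measurableT_comp mr (measurable_curve_ext c). Qed.

Lemma le_line_integral c rho sigma : nonneg_borel rho -> nonneg_borel sigma ->
  (forall x, rho x <= sigma x) -> line_integral c rho <= line_integral c sigma.
Proof.
move=> nr ns rs; have [rc|nrc] := pselect (rectifiable c); last first.
  by rewrite /line_integral; case: ifPn => // /nrc.
rewrite !line_integral_oc//; apply: ge0_le_integral => //.
- by move=> t _; case: nr.
- by apply: measurable_funTS; exact: measurable_along.
- by apply: measurable_funTS; exact: measurable_along.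
Qed.

Lemma line_integralZ c rho (k : R) : nonneg_borel rho -> (0 < k)%R ->
  line_integral c (fun x => k%:E * rho x) = k%:E * line_integral c rho.
Proof.
move=> nr k0; have [rc|nrc] := pselect (rectifiable c); last first.
  rewrite /line_integral; case: ifPn => [//|_].
  by rewrite gt0_muley// lte_fin.
have nkr : nonneg_borel (fun x => k%:E * rho x).
  by apply: (@nonneg_borelM (fun _ => k)) => // _; exact: ltW.
rewrite !line_integral_oc// ge0_integralZl//.
- by apply: measurable_funTS; exact: measurable_along.
- by move=> t _; case: nr.
- by rewrite lee_fin ltW.
Qed.

(** P holds off a family of modulus zero. The witness tau turns finite
conjunctions into maxima, and subcurves have smaller line integrals. *)
Definition curve_ae (P : curve X -> Prop) :=
  exists2 tau, finite_energy tau & forall c, line_integral c tau < +oo -> P c.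

Lemma curve_ae_mono (P Q : curve X -> Prop) : (forall c, P c -> Q c) ->
  curve_ae P -> curve_ae Q.
Proof. by move=> PQ [tau et tP]; exists tau => // c /tP/PQ. Qed.

Lemma curve_aeI (P Q : curve X -> Prop) : curve_ae P -> curve_ae Q ->
  curve_ae (fun c => P c /\ Q c).
Proof.
move=> [t1 e1 P1] [t2 e2 P2].
exists (fun x => maxe (t1 x) (t2 x)); first exact: finite_energy_maxe.
have [[n1 _] [n2 _]] := (e1, e2).
move=> c tc; split; [apply: P1|apply: P2]; apply: le_lt_trans tc;
  by apply: le_line_integral => //; [exact: nonneg_borel_maxe|
    move=> x; rewrite le_max lexx ?orbT].
Qed.

Lemma curve_ae_line_integral rho : finite_energy rho ->
  curve_ae (fun c => line_integral c rho < +oo).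
Proof. by move=> er; exists rho. Qed.

Lemma curve_ae_rectifiable : curve_ae (fun c => rectifiable c).
Proof.
exists (fun=> 0); last by move=> c; exact: line_integral_lty.
split; first by split => //; exact: measurable_cst.
by under eq_integral do rewrite poweR0r ?gt_eqF//; rewrite integral0.
Qed.

Lemma curve_ae_subcurve (P : curve X -> Prop) : curve_ae P ->
  curve_ae (fun c => forall s t (as_ : (curve_start c <= s)%R)
    (st : (s < t)%R) (tb : (t <= curve_stop c)%R), P (subcurve as_ st tb)).
Proof.
move=> [tau et tP]; exists tau => // c tc s t as_ st tb; apply: tP.
have rc := line_integral_lty tc; have [nt _] := et.
rewrite line_integral_subcurve//; apply: le_lt_trans tc.
rewrite line_integral_oc//; apply: ge0_subset_integral => //.
- by apply: measurable_funTS; exact: measurable_along.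
- by move=> u _; case: nt.
- move=> u /=; rewrite !in_itv/= => /andP[su ut].
  by rewrite (le_lt_trans as_ su) (le_trans ut tb).
Qed.

(** Finiteness of its line integral says that a curve spends no length in Z. *)
Lemma finite_energy_infinite_null (Z : set (borelType X)) : measurable Z ->
  m Z = 0 -> finite_energy (fun x => if x \in Z then +oo else 0).
Proof.
move=> mZ Z0.
have mi : measurable_fun setT (fun x : borelType X => if x \in Z then +oo else 0 : \bar R).
  apply: measurable_fun_ifT => //.
  apply: (@measurable_fun_bool _ _ _ _ true).
  rewrite setTI (_ : _ @^-1` _ = Z)//; apply/seteqP; split => x /=.
    exact: set_mem.
  exact: mem_set.
split; first by split => // x; case: ifP.
rewrite (_ : (fun x => _) = (fun x => if x \in Z then +oo else 0)); last first.
  by apply/funext => x; case: ifP => _; rewrite ?poweRyr ?poweR0r// gt_eqF.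
rewrite (_ : \int[m]_x _ = 0)//.
have E x : (if x \in Z then +oo else 0 : \bar R) = (cst +oo \_ Z) x by rewrite patchE.
under eq_integral do rewrite E.
by rewrite -integral_mkcond null_set_integral//; exact: measurable_cst.
Qed.

(** A family of modulus zero is contained in the curves of infinite integral of
one function of finite energy, namely the l^p sum of 2 ^ n times functions
admissible for the family with rapidly decreasing energies. *)
Lemma Mod0_curve_ae (Gamma : set (curve X)) : Mod m p Gamma = 0 ->
  curve_ae (fun c => ~ Gamma c).
Proof.
move=> M0.
pose d (n : nat) : R := (((2 ^+ n) `^ p)^-1 * (2^-1) ^+ n)%R.
have d0 n : (0 < d n)%R by rewrite /d mulr_gt0// ?exprn_gt0// invr_gt0 powR_gt0 exprn_gt0.
have /choice[rho rhoP] : forall n, exists rho : borelType X -> \bar R,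
    [/\ nonneg_borel rho, (forall c, Gamma c -> 1 <= line_integral c rho) &
    \int[m]_x (rho x `^ p) < (d n)%:E].
  move=> n; have : Mod m p Gamma < (d n)%:E by rewrite M0 lte_fin.
  by rewrite /Mod => /ereal_inf_lt[_ [rho [nr Gr] <-] rd]; exists rho.
have c0 n : (0 < 2 ^+ n :> R)%R by rewrite exprn_gt0.
pose g n x := ((2 ^+ n)%:E * rho n x) `^ p.
have ng n : nonneg_borel (fun x => (2 ^+ n)%:E * rho n x).
  by apply: (@nonneg_borelM (fun _ => 2 ^+ n)%R) => //; case: (rhoP n).
have mg n : measurable_fun setT (g n) by exact: measurable_poweR_comp (ng n).
have g0 n x : 0 <= g n x by exact: poweR_ge0.
pose s x := \sum_(n <oo) g n x.
have s0 x : 0 <= s x by apply: nneseries_ge0.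
have ms : measurable_fun setT s by apply: ge0_emeasurable_sum.
pose tau x := s x `^ p^-1.
have nt : nonneg_borel tau.
  split; last by move=> x; exact: poweR_ge0.
  exact: (measurableT_comp (measurable_poweR _) ms).
have tauE x : tau x `^ p = s x by rewrite -poweRrM mulVf ?gt_eqF// poweRe1.
exists tau; first split => //.
  under eq_integral do rewrite tauE.
  rewrite integral_nneseries//.
  apply: (@le_lt_trans _ _ (\sum_(n <oo) ((2^-1) ^+ n)%:E)).
    apply: lee_nneseries => [n _|n _].
      by move=> _; apply: integral_ge0 => x _.
    have [[mr r0] _ rd] := rhoP n.
    have E x : g n x = ((2 ^+ n) `^ p)%:E * (rho n x `^ p).
      by rewrite /g poweRM ?lee_fin ?(ltW (c0 n))// poweR_EFin.
    under eq_integral do rewrite E.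
    rewrite ge0_integralZl ?lee_fin ?powR_ge0//; last 2 first.
    - by have [nr _ _] := rhoP n; exact: measurable_poweR_comp.
    - by move=> x _; exact: poweR_ge0.
    have cp0 : (0 < (2 ^+ n : R) `^ p)%R by rewrite powR_gt0.
    apply: le_trans (lee_wpmul2l _ (ltW rd)) _; first by rewrite lee_fin ltW.
    by rewrite -EFinM lee_fin /d mulrA divff ?mul1r// gt_eqF.
  under eq_eseriesr => n _.
    have -> : ((2^-1) ^+ n = 2 / (2 ^ (n + 1))%:R :> R)%R.
      by rewrite addn1 natrX exprS exprVn invfM mulrA divff// mul1r.
    over.
  have := @cvg_geometric_eseries_half R 2 0.
  by rewrite expr0 divr1 => /cvg_lim ->//; rewrite ltry.
move=> c tc Gc.
have le_n n : (2 ^+ n)%:E <= line_integral c tau.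
  have [nr G1 _] := rhoP n.
  apply: (@le_trans _ _ (line_integral c (fun x => (2 ^+ n)%:E * rho n x))).
    rewrite line_integralZ// -[leLHS]mule1; apply: lee_wpmul2l (G1 _ Gc).
    by rewrite lee_fin ltW.
  apply: le_line_integral => // x.
  have -> : (2 ^+ n)%:E * rho n x = g n x `^ p^-1.
    rewrite /g -poweRrM mulfV ?gt_eqF// poweRe1//.
    by case: (ng n) => _ /(_ x).
  apply: le_poweR => //; first by rewrite invr_ge0 ltW.
  rewrite /s (@nneseriesD1 _ (g ^~ x) n xpredT)//=.
  by rewrite leeDl// nneseries_ge0.
suff E : line_integral c tau = +oo by rewrite E in tc.
apply: eq_infty => x; pose n := Num.bound `|x|%R; apply: le_trans (le_n n).
rewrite lee_fin; apply: le_trans (ler_norm _) _.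
apply: le_trans (ltW (archi_boundP (normr_ge0 x))) _.
by rewrite -natrX ler_nat ltnW// ltn_expl.
Qed.

(** Every positive multiple of the witness is admissible for the family, however
small its energy. *)
Lemma curve_ae_Mod0 (Gamma : set (curve X)) : curve_ae (fun c => ~ Gamma c) ->
  Mod m p Gamma = 0.
Proof.
move=> [tau [nt tp] tG].
have Goo c : Gamma c -> line_integral c tau = +oo.
  move=> Gc; apply/eqP; rewrite -leye_eq leNgt; apply/negP => /tG; exact.
apply/eqP; rewrite eq_le; apply/andP; split; last first.
  apply: le_ereal_inf_tmp => _ [rho _ <-].
  by apply: integral_ge0 => x _; exact: poweR_ge0.
apply/lee_addgt0Pr => e e0; rewrite add0e.
set I0 := \int[m]_x (tau x `^ p) in tp.
have I00 : 0 <= I0 by apply: integral_ge0 => x _; exact: poweR_ge0.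
have If : I0 \is a fin_num by rewrite ge0_fin_numE.
pose k : R := (1 + fine I0 / e)%R.
have k1 : (1 <= k)%R by rewrite lerDl divr_ge0// ?fine_ge0// ltW.
have k0 : (0 < k)%R by exact: lt_le_trans k1.
have ki0 : (0 < k^-1)%R by rewrite invr_gt0.
have nkt : nonneg_borel (fun x => (k^-1)%:E * tau x).
  by apply: (@nonneg_borelM (fun _ => k^-1)%R) => // _; exact: ltW.
apply: (@le_trans _ _ (\int[m]_x (((k^-1)%:E * tau x) `^ p))).
  apply: ereal_inf_lbound; exists (fun x => (k^-1)%:E * tau x) => //.
  split => // c Gc.
  by rewrite line_integralZ// Goo// gt0_muley ?lte_fin// leey.
have E x : ((k^-1)%:E * tau x) `^ p = ((k^-1) `^ p)%:E * (tau x `^ p).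
  by rewrite poweRM ?lee_fin ?(ltW ki0) ?poweR_EFin//; case: nt.
under eq_integral do rewrite E.
rewrite ge0_integralZl ?lee_fin ?powR_ge0//; last 2 first.
- exact: measurable_poweR_comp.
- by move=> x _; exact: poweR_ge0.
apply: (@le_trans _ _ ((k^-1)%:E * I0)).
  apply: lee_wpmul2r => //; rewrite lee_fin.
  by apply: ge1r_powR; rewrite // ki0 invf_le1.
rewrite -(fineK If) -EFinM lee_fin mulrC ler_pdivrMr// /k mulrDr mulr1.
by rewrite mulrC divfK ?gt_eqF// lerDr ltW.
Qed.

End curve_almost_everywhere.

(** * Weak upper gradients along almost every curve *)

Section upper_gradients_along_curves.
Context (R : realType) (X : completeMetricType R).
Context (m : {measure set (borelType X) -> \bar R}) (p : R) (p1 : (1 <= p)%R).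
Implicit Types (rho sigma : borelType X -> \bar R) (c : curve X).
Implicit Types (f h : X -> \bar R) (s t u : R).

Let EFin_norm (r : R) : `|r|%:E = `|r%:E|.
Proof. by []. Qed.

Definition finite_along f c := forall t, f (curve_ext c t) \is a fin_num.

Definition along f c t : R := fine (f (curve_ext c t)).

Definition ug_along f rho c := finite_along f c /\
  forall s t, (curve_start c <= s)%R -> (s <= t)%R -> (t <= curve_stop c)%R ->
  `|along f c t - along f c s|%:E <=
    \int[arclength_measure c]_(u in `]s, t]) rho (curve_ext c u).

Lemma WUG_finite_energy f rho : WUG m p f rho -> finite_energy m p rho.
Proof. by case. Qed.

(** Almost every curve has no subcurve in the exceptional family. A constant
subcurve satisfies the inequality trivially, and every point of a nonconstant
curve is an endpoint of a nonconstant subcurve. *)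
Lemma WUG_along f rho : WUG m p f rho ->
  curve_ae m p (fun c => nonconstant c -> ug_along f rho c).
Proof.
move=> [nr rp /(Mod0_curve_ae p1) M0].
have := curve_aeI p1 (curve_ae_rectifiable m p1) (curve_ae_subcurve M0).
apply: curve_ae_mono => c [rc sub] ncc.
have ab := curve_lt c.
have good s t (as_ : (curve_start c <= s)%R) (st : (s < t)%R) (tb : (t <= curve_stop c)%R) :
    c s <> c t -> [/\ f (c s) \is a fin_num, f (c t) \is a fin_num &
      `|f (c t) - f (c s)| <=
        \int[arclength_measure c]_(u in `]s, t]) rho (curve_ext c u)].
  move=> cst; apply: contrapT => bad; apply: (sub s t as_ st tb); split.
  - exact: subcurve_rectifiable.
  - by exists s, t; rewrite !in_itv/= !lexx (ltW st).
  - by rewrite line_integral_subcurve.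
have fin : finite_along f c.
  move=> v; rewrite /curve_ext.
  have /andP[] := clamp_itv v (ltW ab); set t := clamp _ _ _ => at_ tb.
  apply: contrapT => nfin; have : ~ nonconstant c; last exact.
  have cE u : u \in `[curve_start c, curve_stop c] -> c u = c t.
    rewrite in_itv/= => /andP[au ub]; apply: contrapT => cut; apply: nfin.
    have [ut|tu|ute] := ltgtP u t; last by rewrite ute in cut.
    - by have [_ ] := good u t au ut tb cut.
    - by have [] := good t u at_ tu ub (nesym cut).
  by move=> [s [u [/cE -> /cE ->]]].
split=> // s t as_ st tb.
have sE : curve_ext c s = c s by rewrite curve_ext_id// as_ (le_trans st).
have tE : curve_ext c t = c t by rewrite curve_ext_id// tb (le_trans as_).
rewrite /along sE tE.
have [cst|cst] := pselect (c s = c t).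
  by rewrite cst subrr normr0; apply: integral_ge0 => u _; case: nr.
have {}st : (s < t)%R.
  by rewrite lt_neqAle st andbT; apply/eqP => ste; rewrite ste in cst.
have [fs ft] := good s t as_ st tb cst.
by rewrite EFin_norm EFinB !fineK.
Qed.

Lemma WUG_of_curve_ae h sigma : finite_energy m p sigma ->
  curve_ae m p (fun c => nonconstant c -> finite_along h c /\
    `|along h c (curve_stop c) - along h c (curve_start c)|%:E <=
      line_integral c sigma) -> WUG m p h sigma.
Proof.
move=> [ns sp] ae; split => //; apply: curve_ae_Mod0 => //.
apply: curve_ae_mono ae => c H [rc /H[fin hab] []].
have ab := ltW (curve_lt c).
have aE : curve_ext c (curve_start c) = c (curve_start c) by rewrite curve_ext_id ?lexx.
have bE : curve_ext c (curve_stop c) = c (curve_stop c) by rewrite curve_ext_id ?lexx ?andbT.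
have fa := fin (curve_start c); have fb := fin (curve_stop c).
rewrite aE in fa; rewrite bE in fb.
by move: hab; rewrite /along aE bE EFin_norm EFinB !fineK.
Qed.

Lemma ug_along_between f rho c t u : ug_along f rho c ->
  (curve_start c <= t <= curve_stop c)%R -> (curve_start c <= u <= curve_stop c)%R ->
  `|along f c u - along f c t|%:E <=
    \int[arclength_measure c]_(v in between t u) rho (curve_ext c v).
Proof.
move=> [_ ug] /andP[at_ tb] /andP[au ub].
have [tu|/ltW ut] := leP t u; first by rewrite (between_lt tu) ug.
by rewrite (between_gt ut) distrC ug.
Qed.

(** Arclength has no atoms, so the integral of rho over short intervals around t
is small. *)
Lemma ug_along_continuous f rho c t (e : R) : nonneg_borel rho ->
  line_integral c rho < +oo -> ug_along f rho c ->
  (curve_start c <= t <= curve_stop c)%R -> (0 < e)%R ->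
  \forall u \near t, (curve_start c <= u <= curve_stop c)%R ->
    (`|along f c u - along f c t| < e)%R.
Proof.
move=> nr lr ug tab e0; have rc := line_integral_lty lr.
have mr := measurable_along c nr.
have r0 u : 0 <= rho (curve_ext c u) by case: nr.
pose nu : {measure set (measurableTypeR R) -> \bar R} :=
  density_measure (arclength_measure c) mr r0.
pose D : set (measurableTypeR R) := `]curve_start c, curve_stop c]%classic.
pose G (n : nat) : set (measurableTypeR R) :=
  `](t - n.+1%:R^-1)%R, (t + n.+1%:R^-1)%R]%classic `&` D.
have mG n : measurable (G n) by apply: measurableI; exact: measurable_itv.
have Gt : \bigcap_n G n `<=` [set t].
  move=> x Gx; apply/eqP; rewrite -subr_eq0 -normr_eq0; apply/eqP.
  apply/le_anti; rewrite normr_ge0 andbT; apply/ler_addgt0Pr => d d0; rewrite add0r.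
  near \oo => n.
  have [+ _] := Gx n I; rewrite /= in_itv/= => /andP[xl xr].
  apply: (@le_trans _ _ (n.+1%:R^-1)%R).
    by rewrite ler_distl xr andbT ltW.
  by apply: ltW; near: n; exact: near_infty_natSinv_lt (PosNum d0).
have nuG0 : nu (\bigcap_n G n) = 0.
  rewrite /nu/= /density_measure null_set_integral//.
  - exact: bigcapT_measurable.
  - exact: measurable_funTS.
  apply/eqP; rewrite -measure_le0 -(arclength_measure_set1 rc tab).
  apply: le_measure; rewrite ?inE//; first exact: bigcapT_measurable.
have nuG : nu \o G @ \oo --> nu (\bigcap_n G n).
  apply: nonincreasing_cvg_mu => //.
  - apply: le_lt_trans lr; rewrite line_integral_oc//.
    apply: ge0_subset_integral => //.
      exact: measurable_funTS.
    by move=> x [].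
  - exact: bigcapT_measurable.
  - move=> k n kn; apply/subsetPset; apply: setSI => x /=; rewrite !in_itv/=.
    have : (n.+1%:R^-1 <= k.+1%:R^-1 :> R)%R by rewrite lef_pV2 ?posrE// ler_nat.
    move: (n.+1%:R^-1)%R (k.+1%:R^-1)%R => d1 d2 d12 /andP[x1 x2].
    by rewrite (le_lt_trans _ x1) ?lerD2l ?lerN2// (le_trans x2)// lerD2l.
rewrite nuG0 in nuG.
have /fine_cvgP[[N1 _ finG] /cvgrPdist_lt/(_ e e0)[N2 _ smallG]] := nuG.
pose n := maxn N1 N2.
have := smallG n (leq_maxr _ _); rewrite /= sub0r normrN => Gn.
have Gf : nu (G n) \is a fin_num by exact: (finG n (leq_maxl _ _)).
apply/nbhs_ballP; exists (n.+1%:R^-1)%R => /=; first by rewrite invr_gt0.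
move=> u tu uab; rewrite -lte_fin.
apply: le_lt_trans (ug_along_between ug tab uab) _.
apply: (@le_lt_trans _ _ (nu (G n))).
  apply: ge0_subset_integral => //.
  - exact: measurable_between.
  - exact: measurable_funTS.
  - move=> x tux; split; last exact: between_sub tux.
    have := between_ball tu tux; rewrite /ball/= ltr_distlC => /andP[x1 x2].
    by rewrite /= in_itv/= x1 ltW.
by rewrite -(fineK Gf) lte_fin; apply: le_lt_trans Gn; exact: ler_norm.
Unshelve. all: by end_near. Qed.

(** The criterion behind pasting, the chain rule and the product rule: increments
of h need only be estimated near each point of almost every curve, with
coefficients evaluated at that point. *)
Lemma WUG_frozen_coefficients h rho1 rho2 (W1 W2 : borelType X -> R) (M : R) :
  finite_energy m p rho1 -> finite_energy m p rho2 ->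
  measurable_fun setT W1 -> (forall x, 0 <= W1 x <= M)%R ->
  measurable_fun setT W2 -> (forall x, 0 <= W2 x <= M)%R ->
  curve_ae m p (fun c => nonconstant c -> finite_along h c /\
    forall t (e : R), (curve_start c <= t <= curve_stop c)%R -> (0 < e)%R ->
    \forall u \near t, (curve_start c <= u <= curve_stop c)%R ->
      `|along h c u - along h c t|%:E <=
        (W1 (curve_ext c t) + e)%:E *
          \int[arclength_measure c]_(v in between t u) rho1 (curve_ext c v) +
        (W2 (curve_ext c t) + e)%:E *
          \int[arclength_measure c]_(v in between t u) rho2 (curve_ext c v)) ->
  WUG m p h (fun x => (W1 x)%:E * rho1 x + (W2 x)%:E * rho2 x).
Proof.
move=> e1 e2 mW1 W1M mW2 W2M ae.
have [n1 _] := e1; have [n2 _] := e2.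
have W10 x : (0 <= W1 x)%R by case/andP: (W1M x).
have W20 x : (0 <= W2 x)%R by case/andP: (W2M x).
have M0 : (0 <= M)%R by case/andP: (W1M point); exact: le_trans.
set sigma := (fun x => _ + _).
have ns : nonneg_borel sigma.
  by apply: nonneg_borelD; exact: nonneg_borelM.
have es : finite_energy m p sigma.
  apply: (finite_energy_le_maxe p1 (k := M + M) _ e1 e2) => //.
    exact: addr_ge0.
  have [_ r10] := n1; have [_ r20] := n2.
  move=> x; rewrite EFinD ge0_muleDl ?lee_fin//.
  apply: leeD; apply: lee_pmul; rewrite ?lee_fin ?le_max ?lexx ?orbT//.
  - by case/andP: (W1M x).
  - by case/andP: (W2M x).
apply: WUG_of_curve_ae => //.
have := curve_aeI p1 ae (curve_aeI p1 (curve_ae_line_integral e1) (curve_ae_line_integral e2)).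
apply: curve_ae_mono => c [H [l1 l2]] /H[fin loc].
split => //; have rc := line_integral_lty l1.
have mW (W : borelType X -> R) : measurable_fun setT W ->
    measurable_fun setT (fun t : measurableTypeR R => W (curve_ext c t)).
  by move=> mW; exact: measurableT_comp mW (measurable_curve_ext c).
rewrite (line_integral_oc rc ns).
apply: (@frozen_coefficients_le_integral _ (arclength_measure c)
  (fun t => rho1 (curve_ext c t)) (fun t => rho2 (curve_ext c t))
  (fun t => W1 (curve_ext c t)) (fun t => W2 (curve_ext c t)) M) => //.
- exact: measurable_along.
- by case: n1.
- exact: measurable_along.
- by case: n2.
- by rewrite -line_integral_oc.
- by rewrite -line_integral_oc.
- exact: mW.
- exact: mW.
- exact: ltW (curve_lt c).
Qed.

End upper_gradients_along_curves.

(** * Pointwise minimality *)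

Section minimality.
Context (R : realType) (X : completeMetricType R).
Context (m : {measure set (borelType X) -> \bar R}) (p : R) (p1 : (1 <= p)%R).
Implicit Types (rho sigma : borelType X -> \bar R) (c : curve X).
Implicit Types (f h : X -> \bar R) (s t u : R).

Let p0 : (0 < p)%R. Proof. exact: lt_le_trans p1. Qed.

Lemma measurable_indicR (A : set (borelType X)) : measurable A ->
  measurable_fun setT (\1_A : borelType X -> R).
Proof. by move=> mA; exact: measurable_indic. Qed.

Lemma indic01 (A : set (borelType X)) x : (0 <= (\1_A x : R) <= 1)%R.
Proof. by rewrite indicE; case: (x \in A); rewrite lexx ler01. Qed.

(** At a point of A the increments are estimated with rho alone, elsewhere with
sigma alone. *)
Lemma WUG_paste f rho sigma (A : set (borelType X)) : measurable A ->
  WUG m p f rho -> WUG m p f sigma ->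
  WUG m p f (fun x => (\1_A x)%:E * rho x + (\1_(~` A) x)%:E * sigma x).
Proof.
move=> mA fr fs.
apply: (WUG_frozen_coefficients p1 (M := 1)).
- exact: WUG_finite_energy fr.
- exact: WUG_finite_energy fs.
- exact: measurable_indicR.
- exact: indic01.
- by apply: measurable_indicR; exact: measurableC.
- exact: indic01.
have := curve_aeI p1 (WUG_along p1 fr) (WUG_along p1 fs).
apply: curve_ae_mono => c [ar as_] ncc.
have ugr := ar ncc; have ugs := as_ ncc; split; first by case: ugr.
move=> t e tab e0; apply/nbhs_ballP; exists 1%R => //= u _ uab.
have [[nr _] [ns _]] := (WUG_finite_energy fr, WUG_finite_energy fs).
have ir : 0 <= \int[arclength_measure c]_(v in between t u) rho (curve_ext c v).
  by apply: integral_ge0 => v _; case: nr.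
have is_ : 0 <= \int[arclength_measure c]_(v in between t u) sigma (curve_ext c v).
  by apply: integral_ge0 => v _; case: ns.
have le1 (w : R) (I0 : \bar R) : (1 <= w)%R -> 0 <= I0 -> I0 <= w%:E * I0.
  by move=> w1 I00; rewrite -[leLHS]mul1e lee_wpmul2r// lee_fin.
rewrite !indicE in_setC; case: (curve_ext c t \in A) => /=.
  apply: le_trans (ug_along_between ugr tab uab) _.
  apply: (le_trans (le1 (1 + e)%R _ _ ir)); first by rewrite lerDl ltW.
  by rewrite leeDl// add0r mule_ge0// lee_fin ltW.
apply: le_trans (ug_along_between ugs tab uab) _.
apply: (le_trans (le1 (1 + e)%R _ _ is_)); first by rewrite lerDl ltW.
by rewrite leeDr// add0r mule_ge0// lee_fin ltW.
Qed.

(** Equality of the total integrals forces equality on every measurable set,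
since neither a set nor its complement can lose mass. *)
Lemma le_ge0_integral_eq_ae d (T : measurableType d)
    (mu : {measure set T -> \bar R}) (f1 f2 : T -> \bar R) :
  measurable_fun setT f1 -> measurable_fun setT f2 ->
  (forall x, 0 <= f1 x <= f2 x) -> \int[mu]_x f2 x <= \int[mu]_x f1 x ->
  \int[mu]_x f2 x < +oo -> {ae mu, forall x, f1 x = f2 x}.
Proof.
move=> mf1 mf2 f12 int21 int2.
have f10 x : 0 <= f1 x by case/andP: (f12 x).
have f12' x : f1 x <= f2 x by case/andP: (f12 x).
have f20 x : 0 <= f2 x by exact: le_trans (f10 x) (f12' x).
have le12 A : measurable A -> \int[mu]_(x in A) f1 x <= \int[mu]_(x in A) f2 x.
  by move=> mA; apply: ge0_le_integral => //; exact: measurable_funTS.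
have i1 : mu.-integrable setT f1.
  apply/integrableP; split => //; under eq_integral do rewrite gee0_abs//.
  exact: le_lt_trans (le12 _ measurableT) int2.
have split0 (g : T -> \bar R) A : measurable_fun setT g -> (forall x, 0 <= g x) ->
    measurable A -> \int[mu]_x g x = \int[mu]_(x in A) g x + \int[mu]_(x in ~` A) g x.
  move=> mg g0 mA; rewrite -ge0_integral_setU ?setUv//.
  - exact: measurableC.
  - by rewrite disj_set2E setICr.
have H : ae_eq mu setT f1 f2.
  apply: integral_ae_eq => // A AT mA.
  apply/eqP; rewrite eq_le le12//= leNgt; apply/negP => lt12.
  have fin (g : T -> \bar R) B : measurable_fun setT g -> (forall x, 0 <= g x) ->
      \int[mu]_x g x < +oo -> measurable B -> \int[mu]_(x in B) g x \is a fin_num.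
    move=> mg g0 goo mB; rewrite ge0_fin_numE; last exact: integral_ge0.
    by apply: le_lt_trans goo; apply: ge0_subset_integral.
  have int1 : \int[mu]_x f1 x < +oo by apply: le_lt_trans (le12 _ measurableT) int2.
  move: int21; apply/negP; rewrite -ltNge (split0 f1 A)// (split0 f2 A)//.
  apply: lte_leD => //; first by apply: fin => //; exact: measurableC.
  by apply: le12; exact: measurableC.
by apply: filterS H => x; apply.
Qed.

(** The pasting of a minimal weak upper gradient and any other one is their
pointwise minimum, whose energy cannot be smaller. *)
Lemma minimal_WUG_le f rho sigma : minimal_WUG m p f rho -> WUG m p f sigma ->
  {ae m, forall x, rho x <= sigma x}.
Proof.
move=> [fr minr] fs.
have [[[mr r0] rp] [[ms s0] sp]] := (WUG_finite_energy fr, WUG_finite_energy fs).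
pose A : set (borelType X) := [set x | rho x <= sigma x].
have mA : measurable A.
  by rewrite -[A]setTI; exact: measurable_lee.
have ft := WUG_paste mA fr fs; set tau := (fun x => _ + _) in ft.
have [[mt t0] tp] := WUG_finite_energy ft.
have tauE x : tau x = if x \in A then rho x else sigma x.
  rewrite /tau !indicE in_setC.
  by case: (x \in A) => /=; rewrite !mul1e mul0e ?adde0 ?add0e.
have ler : \int[m]_x (rho x `^ p) <= \int[m]_x (tau x `^ p).
  have pn0 : p != 0%R by rewrite gt_eqF.
  have := minr _ ft => /(@le_poweR R p _ _ (ltW p0) (Lnorm_ge0 _ _ _)).
  rewrite !poweR_Lnorm//.
  under eq_integral do rewrite gee0_abs//.
  by under [X in _ <= X -> _]eq_integral do rewrite gee0_abs//.
have := @le_ge0_integral_eq_ae _ _ m (fun x => tau x `^ p) (fun x => rho x `^ p).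
move=> /(_ (measurable_poweR_comp p (conj mt t0)) (measurable_poweR_comp p (conj mr r0))).
have tr x : 0 <= tau x `^ p <= rho x `^ p.
  rewrite poweR_ge0/=; apply: le_poweR => //; first exact: ltW.
  rewrite tauE; case: ifPn => // /negP xA.
  by apply: ltW; rewrite ltNge; apply/negP => rs; apply: xA; rewrite inE.
move=> /(_ tr ler rp); apply: filterS => x rt.
have [//|sr] := leP (rho x) (sigma x).
have E (y : \bar R) : 0 <= y -> y = (y `^ p) `^ p^-1.
  by move=> y0; rewrite -poweRrM mulfV ?gt_eqF// poweRe1.
suff rs : rho x = sigma x by rewrite rs ltxx in sr.
rewrite (E (rho x))// -rt -E// tauE ifN//.
by apply/negP; rewrite inE /A/= leNgt sr.
Qed.

End minimality.

(** * Values in a null set *)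

(** x - psi x is 1-Lipschitz, h-close to the identity and locally constant on N:
psi x is the measure of the part left of x of a small open set containing N. *)
Lemma null_set_flattening (R : realType) (N : set R) (h : R) :
  measurable N -> lebesgue_measure N = 0 -> (0 < h)%R ->
  exists psi : R -> R, [/\ forall x, (0 <= psi x <= h)%R,
    forall x y, (x <= y)%R -> (0 <= psi y - psi x <= y - x)%R &
    forall x, N x -> exists2 d : R, (0 < d)%R &
      forall y, (`|y - x| < d)%R -> (psi y - psi x = y - x)%R].
Proof.
move=> mN N0 h0.
have Noo : lebesgue_measure N < +oo by rewrite N0 ltry.
have [U [oU NU UN]] := lebesgue_regularity_outer mN Noo h0.
pose la : {measure set (measurableTypeR R) -> \bar R} := lebesgue_measure.
have mU : measurable (U : set (measurableTypeR R)) by exact: open_measurable.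
have laU : la U < h%:E.
  rewrite -(setDUK NU).
  apply: le_lt_trans (measureU2 _ _ _) _ => //; first exact: measurableD.
  by rewrite [X in X + _](_ : _ = 0)// add0e.
pose V x : set (measurableTypeR R) := U `&` `]-oo, x]%classic.
have mV x : measurable (V x) by exact: measurableI.
have laV x : la (V x) <= la U by apply: le_measure; rewrite ?inE//; exact: subIsetl.
have fV x : la (V x) \is a fin_num.
  by rewrite ge0_fin_numE//; apply: le_lt_trans (laV x) (lt_trans laU _); rewrite ltry.
pose psi x := fine (la (V x)).
have psiB x y : (x <= y)%R -> (psi y - psi x)%:E = la (U `&` `]x, y]%classic).
  move=> xy; have VE : la (V y) = la (V x) + la (U `&` `]x, y]%classic).
    rewrite -measureU//.
    - congr (la _); rewrite /V -setIUr; congr (_ `&` _).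
      apply/seteqP; split => z /=; rewrite !in_itv/=.
        by move=> zy; have [zx|xz] := leP z x; [left|right; apply/andP].
      by move=> [/le_trans|/andP[]//]; apply.
    - by apply: measurableI => //; exact: measurable_itv.
    - apply/seteqP; split => // z [[_ /=]]; rewrite in_itv/= => zx [_ /=].
      by rewrite in_itv/= ltNge zx.
  by rewrite EFinB /psi !fineK// VE addeAC subee// add0e.
have lac (x y : R) : (x <= y)%R -> la `]x, y]%classic = (y - x)%:E.
  rewrite le_eqVlt => /orP[/eqP ->|xy]; first by
    rewrite set_itv_ge ?bnd_simp ?ltxx// measure0 subrr.
  by rewrite /la/= lebesgue_measure_itv/= lte_fin xy EFinB.
exists psi; split.
- move=> x; rewrite -!lee_fin fineK// measure_ge0/=.
  exact: le_trans (laV x) (ltW laU).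
- move=> x y xy; rewrite -!lee_fin psiB// measure_ge0/= -lac//.
  apply: le_measure; rewrite ?inE.
  + by apply: measurableI => //; exact: measurable_itv.
  + exact: measurable_itv.
  + exact: subIsetr.
- move=> x /NU Ux.
  have /nbhs_ballP[d /= d0 dU] : nbhs x U by exact: open_nbhs_nbhs.
  have P u v : ball x d u -> ball x d v -> (u <= v)%R -> (psi v - psi u = v - u)%R.
    rewrite /ball/= !ltr_distlC => /andP[u1 u2] /andP[v1 v2] uv.
    apply: EFin_inj; rewrite psiB// -lac//; congr (la _).
    apply/setIidPr => z /=; rewrite in_itv/= => /andP[uz zv]; apply: dU.
    by rewrite /ball/= ltr_distlC (lt_trans u1 uz) (le_lt_trans zv v2).
  exists d => // y yx; have xx : ball x d x by exact: ballxx.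
  have xy : ball x d y by rewrite /ball/= distrC.
  have [xley|/ltW ylex] := leP x y; first exact: P.
  by apply: oppr_inj; rewrite !opprB; exact: P.
Qed.

Section exceptional_values.
Context (R : realType) (X : completeMetricType R).
Context (m : {measure set (borelType X) -> \bar R}) (p : R) (p1 : (1 <= p)%R).
Implicit Types (rho sigma : borelType X -> \bar R) (c : curve X).
Implicit Types (f h q : X -> \bar R) (s t u : R).

(** Compose f with a map that is locally constant on N and uniformly close to
the identity: along a curve the composition does not vary on E. *)
Lemma WUG_drop_null_values f rho (E : set (borelType X)) (N : set R) :
  WUG m p f rho -> measurable E -> measurable N -> lebesgue_measure N = 0 ->
  curve_ae m p (fun c => nonconstant c ->
    forall t, E (curve_ext c t) -> N (along f c t)) ->
  WUG m p f (fun x => (\1_(~` E) x)%:E * rho x).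
Proof.
move=> fr mE mN N0 aeN; have er := WUG_finite_energy fr; have [nr rp] := er.
have [mr r0] := nr.
have mCE := measurable_indicR (measurableC mE).
have ns : nonneg_borel (fun x => (\1_(~` E) x)%:E * rho x).
  by apply: nonneg_borelM => // x; case/andP: (indic01 (R:=R) (~` E) x).
apply: WUG_of_curve_ae => //.
  apply: (finite_energy_le_maxe p1 ns er er ler01) => x.
  rewrite maxxx mul1e indicE.
  by case: (x \in _); rewrite ?mul1e// mul0e.
have := curve_aeI p1 aeN (curve_aeI p1 (WUG_along p1 fr) (curve_ae_line_integral er)).
apply: curve_ae_mono => c [+ [+ lr]] ncc => /(_ ncc) EN /(_ ncc) ug.
split; first by case: ug.
have rc := line_integral_lty lr; have ab := ltW (curve_lt c).
rewrite line_integral_oc//.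
apply/lee_addgt0Pr => h h0.
have [psi [psih psiL psiN]] := null_set_flattening mN N0 h0.
pose k t := (along f c t - psi (along f c t))%R.
have kL t u : (`|k u - k t| <= `|along f c u - along f c t|)%R.
  rewrite /k; move: (along f c u) (along f c t) => x y.
  wlog xy : x y / (x <= y)%R => [W|].
    have [xy|/ltW yx] := leP x y; first exact: W.
    by rewrite distrC [leRHS]distrC; exact: W.
  have /andP[] := psiL _ _ xy.
  move=> q1 q2; rewrite (distrC x) (distrC (x - psi x)%R).
  by rewrite !ger0_norm; lra.
have mc (w : borelType X -> R) : measurable_fun setT w ->
    measurable_fun setT (fun t : measurableTypeR R => w (curve_ext c t) : R).
  by move=> mw; exact: measurableT_comp mw (measurable_curve_ext c).
apply: (@le_trans _ _ (`|k (curve_stop c) - k (curve_start c)|%:E + h%:E)).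
  rewrite -EFinD lee_fin.
  have := psih (along f c (curve_stop c)); have := psih (along f c (curve_start c)).
  rewrite /k; move: (along f c (curve_stop c)) (along f c (curve_start c)) => x y.
  move=> /andP[y1 y2] /andP[x1 x2].
  apply: le_trans (lerD (lexx _) (_ : `|psi x - psi y| <= h)%R).
    apply: le_trans (ler_normD _ _).
    by rewrite [X in (_ <= `|X|)%R](_ : _ = x - y)%R//; lra.
  by rewrite ler_norml; apply/andP; split; lra.
rewrite leeD2r//.
rewrite (_ : \int[_]_(t in _) _ =
    \int[arclength_measure c]_(t in `]curve_start c, curve_stop c])
    ((\1_(~` E) (curve_ext c t))%:E * rho (curve_ext c t) + 0%:E * 0)); last first.
  by apply: eq_integral => t _; rewrite mule0 adde0.
apply: (@frozen_coefficients_le_integral _ (arclength_measure c)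
  (fun t => rho (curve_ext c t)) (fun=> 0)
  (fun t => \1_(~` E) (curve_ext c t)) (fun=> 0%R) 1) => //.
- exact: measurable_along.
- by rewrite -line_integral_oc.
- by rewrite integral0.
- exact: mc.
- by move=> t; exact: indic01.
- by move=> t; rewrite lexx ler01.
move=> t e tab e0.
have i0 u : 0 <= \int[arclength_measure c]_(v in between t u) rho (curve_ext c v).
  by apply: integral_ge0 => v _.
have [Et|Et] := pselect (E (curve_ext c t)).
  have [d d0 psid] := psiN _ (EN t Et).
  apply: filterS (ug_along_continuous nr lr ug tab d0) => u + uab => /(_ uab) /psid.
  move=> psiE; rewrite (_ : k u - k t = 0)%R; last by rewrite /k; lra.
  rewrite normr0 integral0 mule0 adde0; apply: mule_ge0 => //.
  by rewrite lee_fin addr_ge0// ltW.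
apply/nbhs_ballP; exists 1%R => //= u _ uab.
rewrite [X in _ + X](_ : _ = 0); last by rewrite integral0 mule0.
rewrite adde0 indicE mem_set//=.
apply: (@le_trans _ _ (`|along f c u - along f c t|%:E)).
  by rewrite lee_fin; exact: kL.
apply: le_trans (ug_along_between ug tab uab) _.
by rewrite -[leLHS]mul1e lee_wpmul2r// lee_fin lerDl ltW.
Qed.

(** The function is constant along almost every curve because its upper gradient
can be taken to vanish off a null set; a nonzero constant would force the curve
into that null set. *)
Lemma WUG_ae_zero q : WUG m p q !=set0 -> {ae m, forall x, q x = 0} ->
  curve_ae m p (fun c => nonconstant c -> forall t, q (curve_ext c t) = 0).
Proof.
move=> [rho qr] [Z [mZ Z0 qZ]].
have [nr _] := WUG_finite_energy qr; have [mr r0] := nr.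
have mCZ := measurableC mZ.
have q0 x : (~` Z) x -> q x = 0 by move=> Zx; apply: contrapT => /qZ.
have aeN : curve_ae m p (fun c => nonconstant c ->
    forall t, (~` Z) (curve_ext c t) -> [set 0%R] (along q c t)).
  apply: curve_ae_mono (curve_ae_rectifiable m p1) => c _ _ t /q0 qt.
  by rewrite /along qt.
have := WUG_drop_null_values qr mCZ (measurable_set1 _) (lebesgue_measure_set1 _) aeN.
rewrite setCK => qZr.
pose z (x : borelType X) : \bar R := if x \in Z then +oo else 0.
have ez : finite_energy m p z := finite_energy_infinite_null p1 mZ Z0.
have [nz _] := ez; have [mz z0] := nz.
have := curve_aeI p1 (WUG_along p1 qZr) (curve_ae_line_integral ez).
apply: curve_ae_mono => c [+ lz] ncc => /(_ ncc) [fin ug].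
have rc := line_integral_lty lz; have ab := ltW (curve_lt c).
rewrite line_integral_oc// in lz.
set J := \int[_]_(_ in _) _ in lz.
have mzc := measurable_along c nz.
have J0 : J = 0.
  have Jf : J \is a fin_num.
    by rewrite ge0_fin_numE//; apply: integral_ge0 => t _; exact: z0.
  have : J + J = J.
    rewrite /J -ge0_integralD//; try exact: measurable_funTS.
    by apply: eq_integral => t _; rewrite /z; case: ifP; rewrite ?adde0.
  rewrite -(fineK Jf) -EFinD => -[JJ]; congr (_%:E); lra.
have qa t : along q c t = along q c (curve_start c).
  have /andP[] := clamp_itv t ab; set v := clamp _ _ _ => av vb.
  have -> : along q c t = along q c v.
    by rewrite /along /curve_ext [in RHS]clamp_id// av vb.
  apply/eqP; rewrite -subr_eq0 -normr_eq0 eq_le normr_ge0 andbT -lee_fin.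
  suff : `|along q c v - along q c (curve_start c)|%:E <= J by rewrite J0.
  apply: le_trans (ug _ _ (lexx _) av vb) _.
  apply: (@le_trans _ _ (\int[arclength_measure c]_(u in `]curve_start c, v]) z (curve_ext c u))).
    apply: ge0_le_integral => //.
    - by move=> u _; rewrite mule_ge0// lee_fin indicE.
    - have [nZr _] := WUG_finite_energy qZr.
      by apply: measurable_funTS; exact: (measurable_along c nZr).
    - exact: measurable_funTS.
    - move=> u _; rewrite /z indicE; case: ifP; rewrite ?leey// mul0e//.
  apply: ge0_subset_integral => //; first exact: measurable_funTS.
  by move=> u /=; rewrite !in_itv/= => /andP[-> uv]; exact: le_trans vb.
have [qa0|qa0] := eqVneq (along q c (curve_start c)) 0%R.
  by move=> t; rewrite -(fineK (fin t)) -[fine _]/(along q c t) qa qa0.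
have zt t : curve_ext c t \in Z.
  rewrite inE; apply: contrapT => /q0 qt.
  by move: qa0; rewrite -(qa t) /along qt eqxx.
have := nonconstant_arclength_gt0 rc ncc; have : J = +oo.
  rewrite /J; under eq_integral do rewrite /z zt.
  rewrite integral_cst//.
  by rewrite gt0_mulye//; exact: nonconstant_arclength_gt0.
by rewrite J0.
Qed.

End exceptional_values.

(** * Differentiability of Lipschitz functions *)

Section lipschitz_measure.
Context (R : realType) (phi : R -> R) (M : R).
Hypothesis phiM : forall x y, (`|phi x - phi y| <= M * `|x - y|)%R.

(** Adding M x makes an M-Lipschitz function nondecreasing, so that it is the
distribution function of a measure. *)
Definition tilt (x : R) : R := (phi x + M * x)%R.

Lemma tilt_increment x y : (x <= y)%R ->
  (0 <= tilt y - tilt x <= 2 * M * (y - x))%R.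
Proof.
move=> xy; have := phiM y x; rewrite (ger0_norm (_ : 0 <= y - x)%R) ?subr_ge0//.
rewrite ler_norml /tilt => /andP[h1 h2].
by apply/andP; split; move: h1 h2; rewrite !mulrBr; lra.
Qed.

Lemma lipschitz_constant_ge0 : (0 <= M)%R.
Proof. by have := phiM 1 0; rewrite subr0 normr1 mulr1; exact: le_trans. Qed.

Let tilt_nd : nondecreasing tilt.
Proof. by move=> x y /tilt_increment/andP[]; rewrite subr_ge0. Qed.

Let tilt_rc : right_continuous tilt.
Proof.
move=> x; apply/(@cvgrPdist_le _ R^o) => e e0.
have M2 : (0 < 2 * M + 1)%R by rewrite ltr_wpDl// mulr_ge0// lipschitz_constant_ge0.
have eM : (0 < e / (2 * M + 1))%R by rewrite divr_gt0.
near=> u.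
have xu : (x < u)%R by near: u; exact: nbhs_right_gt.
have ux : (u < x + e / (2 * M + 1))%R.
  by near: u; apply: nbhs_right_lt; rewrite ltrDl.
have /andP[t0 t1] := tilt_increment (ltW xu).
rewrite distrC ger0_norm//; apply: le_trans t1 _.
rewrite -ltrBlDl in ux; have M0 := lipschitz_constant_ge0.
apply: (@le_trans _ _ ((2 * M + 1) * (u - x)))%R.
  by rewrite ler_pM2r ?subr_gt0// lerDl.
by rewrite mulrC -ler_pdivlMr// ltW.
Unshelve. all: by end_near. Qed.

HB.instance Definition _ := isCumulative.Build R _ R tilt tilt_nd tilt_rc.

Definition tilt_measure : {measure set (measurableTypeR R) -> \bar R} :=
  lebesgue_stieltjes_measure tilt.

Lemma tilt_measure_oc x y : (x <= y)%R ->
  tilt_measure `]x, y]%classic = (tilt y - tilt x)%:E.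
Proof.
move=> xy.
rewrite /tilt_measure/= /lebesgue_stieltjes_measure/= /measure_extension/=.
by rewrite measurable_mu_extE/= ?wlength_itv_bnd//; exact: is_ocitv.
Qed.

End lipschitz_measure.

Lemma lebesgue_measure_oc (R : realType) (x y : R) : (x <= y)%R ->
  lebesgue_measure `]x, y]%classic = (y - x)%:E.
Proof.
rewrite le_eqVlt => /orP[/eqP ->|xy].
  by rewrite set_itv_ge ?bnd_simp ?ltxx// measure0 subrr.
by rewrite lebesgue_measure_itv/= lte_fin xy EFinB.
Qed.

(** The measures attached to phi and - phi add up to a multiple of the Lebesgue
measure, so both are absolutely continuous. *)
Lemma tilt_measure_dominated (R : realType) (phi : R -> R) (M : R)
    (phiM : forall x y, (`|phi x - phi y| <= M * `|x - y|)%R)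
    (A : set (measurableTypeR R)) :
  measurable A -> lebesgue_measure A = 0 -> tilt_measure phiM A = 0.
Proof.
move=> mA A0.
have phiNM x y : (`|- phi x - - phi y| <= M * `|x - y|)%R.
  by rewrite -opprD normrN.
pose s : {measure set (measurableTypeR R) -> \bar R} :=
  measure_add (tilt_measure phiM) (tilt_measure phiNM).
have M20 : (0 <= 2 * M)%R by rewrite mulr_ge0// (lipschitz_constant_ge0 phiM).
pose l : {measure set (measurableTypeR R) -> \bar R} :=
  mscale (NngNum M20) lebesgue_measure.
have sE B : s B = tilt_measure phiM B + tilt_measure phiNM B by exact: measure_addE.
have lE B : l B = (2 * M)%:E * lebesgue_measure B by [].
have soc u v : (u <= v)%R -> s `]u, v]%classic = (2 * M * (v - u))%:E.
  move=> uv; apply: etrans (sE _) _.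
  rewrite (tilt_measure_oc phiM uv) (tilt_measure_oc phiNM uv) -EFinD /tilt.
  by congr EFin; rewrite !mulrBr; lra.
have loc u v : (u <= v)%R -> l `]u, v]%classic = (2 * M * (v - u))%:E.
  by move=> uv; apply: etrans (lE _) _; rewrite (lebesgue_measure_oc uv) -EFinM.
have sl : s A = l A.
  apply: (@measure_unique _ R (measurableTypeR R) (@ocitv R)
    (fun n => `](- n%:R)%R, n%:R]%classic) _ _ _ _ s l) => //.
  - exact: ocitvI.
  - by move=> i; exact: is_ocitv.
  - rewrite -subTset => x _; exists (Num.bound `|x|%R) => //=.
    have := archi_boundP (normr_ge0 x); rewrite ltr_norml => /andP[h1 h2].
    by rewrite in_itv/= h1 ltW.
  - move=> B /ocitvP[->|[[u v] /= uv ->]].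
      by rewrite (measure0 s) (measure0 l).
    by rewrite (soc _ _ (ltW uv)) (loc _ _ (ltW uv)).
  - move=> k; rewrite soc ?ltry//.
    by rewrite (@le_trans _ _ 0%R) ?oppr_le0 ?ler0n.
have : s A = 0 by rewrite sl lE A0 mule0.
rewrite sE => /eqP.
by rewrite padde_eq0// => /andP[/eqP].
Qed.

(** Radon-Nikodym derivatives of the measure attached to phi are derivatives of
phi at almost every point, by the fundamental theorem of calculus. *)
Lemma lipschitz_ae_derivable (R : realType) (phi : R -> R) (M : R)
    (phiM : forall x y, (`|phi x - phi y| <= M * `|x - y|)%R) :
  {ae lebesgue_measure, forall x, derivable phi x 1}.
Proof.
have loc (n : nat) : {ae lebesgue_measure,
    forall x, (- n%:R < x < n%:R)%R -> derivable phi x 1}.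
  pose a : R := (- n%:R)%R; pose b : R := n%:R.
  have ab : (a <= b)%R by rewrite (@le_trans _ _ 0%R) ?oppr_le0 ?ler0n.
  pose D : set (measurableTypeR R) := `]a, b]%classic.
  have mD : measurable D by exact: measurable_itv.
  have Doo : tilt_measure phiM D < +oo by rewrite tilt_measure_oc// ltry.
  pose nu : {finite_measure set (measurableTypeR R) -> \bar R} := mfrestr mD Doo.
  pose la : {sigma_finite_measure set (measurableTypeR R) -> \bar R} := lebesgue_measure.
  have nula : nu `<< la.
    move=> A nA B mB BA; have lB : lebesgue_measure B = 0 by exact: nA.
    have -> : nu B = tilt_measure phiM (B `&` D) by [].
    apply: tilt_measure_dominated; first exact: measurableI.
    apply: (subset_measure0 _ _ _ lB) => //; first exact: measurableI.
  have [f [f0 ffin intf fE]] := radon_nikodym_sigma_finite nula.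
  pose g := fine \o f.
  have gE : EFin \o g = f by apply/funext => x /=; rewrite fineK.
  have intg (y : R) : lebesgue_measure.-integrable `]-oo, y]%classic (EFin \o g).
    by rewrite gE; apply: integrableS intf => //; exact: measurable_itv.
  have locg : locally_integrable [set: R] g.
    rewrite -(patch_setT 0%R g); apply: integrable_locally => //.
    by rewrite gE.
  have := FTC1Ny intg locg; set F := (fun x => _).
  apply: filterS; first exact: (ae_filter_ringOfSetsType lebesgue_measure).
  move=> x [dF _] /andP[ax xb].
  have FE y : (a <= y <= b)%R -> F y = (tilt phi M y - tilt phi M a)%R.
    move=> /andP[ay yb]; rewrite /F /Rintegral.
    rewrite -[X in X = _](_ : fine (nu `]-oo, y]%classic) = _); last first.
      rewrite fE; last exact: measurable_itv.
      by congr fine; apply: eq_integral => z _; rewrite /= fineK.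
    have -> : nu `]-oo, y]%classic = tilt_measure phiM `]a, y]%classic.
      have -> : nu `]-oo, y]%classic = tilt_measure phiM (`]-oo, y]%classic `&` D) by [].
      congr (tilt_measure _ _); apply/seteqP; split => z; rewrite /D /= !in_itv/=.
        by move=> [-> /andP[->]].
      by move=> /andP[az zy]; rewrite zy az (le_trans zy yb).
    by rewrite tilt_measure_oc.
  have dphi : derivable (fun y => F y + (tilt phi M a - M * y))%R x 1.
    by apply: derivableD => //; apply: derivableB => //; exact: derivableM.
  apply: near_eq_derivable dphi.
  have := near_in_itvoo (_ : x \in `]a, b[).
  rewrite in_itv/= ax xb => /(_ isT); apply: filterS => y.
  rewrite in_itv/= => /andP[ay yb]; rewrite FE ?(ltW ay) ?(ltW yb)// /tilt; lra.
have H : {ae lebesgue_measure, forall x, forall n : nat,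
    (- n%:R < x < n%:R)%R -> derivable phi x 1}.
  exact/ae_foralln.
move: H; apply: filterS; first exact: (ae_filter_ringOfSetsType lebesgue_measure).
move=> x Hx; apply: (Hx (Num.bound `|x|%R)).
by rewrite -ltr_norml archi_boundP.
Qed.

(** The derivative is written as an upper limit of difference quotients to make
it a Borel function on the whole line. *)
Lemma lipschitz_ae_is_derive (R : realType) (phi : R -> R) (M : R)
    (phiM : forall x y, (`|phi x - phi y| <= M * `|x - y|)%R) :
  exists (N : set R) (D : R -> R), [/\ measurable N, lebesgue_measure N = 0,
    measurable_fun setT D & forall x, ~ N x -> is_derive x (1 : R)%R phi (D x)].
Proof.
have [N [mN N0 dN]] := lipschitz_ae_derivable phiM.
pose q (n : nat) (x : R) : R := (n.+1%:R * (phi (x + n.+1%:R^-1) - phi x))%R.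
pose D x := fine (limn_esup (fun n => (q n x)%:E)).
have cphi : continuous phi.
  move=> x; apply/cvgrPdist_le => e e0.
  have M1 : (0 < M + 1)%R by rewrite ltr_wpDl// (lipschitz_constant_ge0 phiM).
  apply/nbhs_ballP; exists (e / (M + 1))%R => /=; first by rewrite divr_gt0.
  move=> y; rewrite /ball/= => /ltW xy; apply: le_trans (phiM x y) _.
  apply: (@le_trans _ _ ((M + 1) * `|x - y|))%R.
    by rewrite ler_wpM2r// lerDl.
  by rewrite mulrC -ler_pdivlMr.
have mphi : measurable_fun setT phi by exact: continuous_measurable_fun.
exists N, D; split => //.
  apply: (measurableT_comp (fine_measurable measurableT)).
  apply: measurable_fun_limn_esup => n; apply/measurable_EFinP.
  apply: measurable_funM => //; apply: measurable_funB => //.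
  by apply: measurableT_comp => //; exact: measurable_funD.
move=> x Nx; have dx : derivable phi x 1%R by apply: contrapT => /dN.
apply: DeriveDef => //.
rewrite /D.
have cv : (fun n => (q n x)%:E) @ \oo --> ('D_1 phi x)%:E.
  apply: cvg_EFin; first by apply: nearW.
  have H : (h^-1 *: (phi (h *: 1 + x) - phi x))%R @[h --> 0%R^'] --> 'D_1 phi x by exact: dx.
  apply/cvgrPdist_lt => e e0.
  have /cvgrPdist_lt/(_ e e0) := H; rewrite /dnbhs/= => /nbhs_ballP[d /= d0 Hd].
  near=> n.
  have hd : (n.+1%:R^-1 < d)%R.
    by near: n; exact: near_infty_natSinv_lt (PosNum d0).
  pose h : R := (n.+1%:R^-1)%R.
  have h0 : (0 < h)%R by rewrite invr_gt0.
  have := Hd h; rewrite /ball/= sub0r normrN gtr0_norm//.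
  move=> /(_ hd); rewrite gt_eqF// => /(_ isT).
  have -> : q n x = (h^-1 *: (phi (h *: 1 + x) - phi x))%R; last by [].
  have -> : (h *: 1 + x = x + h)%R by rewrite addrC; congr (_ + _)%R; exact: mulr1.
  by rewrite /q /h invrK.
by rewrite limn_esup_lim (cvg_lim _ (cvg_esups cv)).
Unshelve. all: by end_near. Qed.

Section metric_derivative.
Context (R : realType) (phi : R -> R) (x D : R).
Hypothesis dphi : is_derive x (1 : R)%R phi D.

Lemma is_derive_increment (e : R) : (0 < e)%R -> \forall y \near x,
  (`|phi y - phi x - D * (y - x)| <= e * `|y - x|)%R.
Proof.
move=> e0; have [dx Dx] := dphi.
have H : (h^-1 *: (phi (h *: 1 + x) - phi x))%R @[h --> 0%R^'] --> D.
  by rewrite -Dx; exact: dx.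
have /cvgrPdist_le/(_ e e0) := H; rewrite /dnbhs/= => /nbhs_ballP[d /= d0 Hd].
apply/nbhs_ballP; exists d => // y; rewrite /ball/= distrC => yx.
have [->|yx0] := eqVneq y x; first by rewrite !subrr mulr0 subrr normr0 mulr0.
have h0 : (y - x != 0)%R by rewrite subr_eq0.
have := Hd (y - x)%R; rewrite /ball/= sub0r normrN => /(_ yx h0).
have -> : ((y - x) *: 1 + x = y)%R.
  by apply: etrans (subrK x y); congr (_ + _)%R; exact: mulr1.
rewrite -[(_ *: _)%R]/((y - x)^-1 * (phi y - phi x))%R => H1.
have -> : (phi y - phi x - D * (y - x) =
  - ((D - (y - x)^-1 * (phi y - phi x)) * (y - x)))%R.
  by rewrite mulrBl mulrAC mulVf// mul1r opprB.
by rewrite normrN normrM ler_wpM2r.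
Qed.

Lemma is_derive_abs_increment (e : R) : (0 < e)%R -> \forall y \near x,
  (`|phi y - phi x| <= (`|D| + e) * `|y - x| /\
   `|D| * `|y - x| <= `|phi y - phi x| + e * `|y - x|)%R.
Proof.
move=> e0; apply: filterS (is_derive_increment e0) => y H; split.
  rewrite mulrDl -normrM -{1}(subrK (D * (y - x)) (phi y - phi x))%R addrC.
  by apply: le_trans (ler_normD _ _) _; rewrite lerD2l.
rewrite -normrM -[X in (`|X| <= _)%R](subKr (phi y - phi x))%R.
by apply: le_trans (ler_normB _ _) _; rewrite lerD2l.
Qed.

Lemma lip_is_derive : lip phi x = `|D|%:E.
Proof.
rewrite /lip /lime_sup limf_esupE; apply/eqP; rewrite eq_le; apply/andP; split.
  apply/lee_addgt0Pr => e e0.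
  pose V : set R := [set y | (`|phi y - phi x| <= (`|D| + e) * `|y - x|)%R /\ y != x].
  apply: (@le_trans _ _ (ereal_sup
      [set (`|phi s - phi x| / `|s - x|)%:E | s in V])).
    apply: ereal_inf_lbound; exists V => //.
    rewrite /dnbhs /within/=.
    by apply: filterS (is_derive_abs_increment e0) => y [].
  apply: ge_ereal_sup => _ [y [Hy yx] <-].
  by rewrite -EFinD lee_fin ler_pdivrMr// normr_gt0 subr_eq0.
apply: le_ereal_inf_tmp => _ [V VF <-].
apply/lee_subgt0Pr => e e0.
have VF' : \forall y \near x, y != x -> V y by exact: VF.
have /nbhs_ballP[d1 /= d10 H1] := VF'.
have /nbhs_ballP[d2 /= d20 H2] := is_derive_abs_increment e0.
pose d := Num.min d1 d2; have d0 : (0 < d)%R by rewrite lt_min d10.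
pose y := (x + d / 2)%R.
have yx : y != x by rewrite /y -subr_eq0 addrAC subrr add0r gt_eqF// divr_gt0.
have By : (`|x - y| < d)%R.
  rewrite /y opprD addrA subrr add0r normrN gtr0_norm ?divr_gt0//.
  by rewrite ltr_pdivrMr// ltr_pMr// ltr1n.
have Vy : V y by apply: H1 => //; apply: lt_le_trans By _; rewrite ge_min lexx.
have dd2 : (d <= d2)%R by rewrite ge_min lexx orbT.
have [_ Dy] := H2 y (lt_le_trans By dd2).
apply: (@le_trans _ _ (`|phi y - phi x| / `|y - x|)%:E); last first.
  by apply: ereal_sup_ubound; exists y.
rewrite -EFinB lee_fin ler_pdivlMr ?normr_gt0 ?subr_eq0// mulrBl.
by rewrite lerBlDr.
Qed.

End metric_derivative.

(** * Chain rule *)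

(** A function with values in the extended reals is determined by its rational
superlevel sets, and each of these is Borel off a null set. *)
Lemma completion_measurable_Borel d (T : measurableType d) (R : realType)
    (m : {measure set T -> \bar R}) (f : T -> \bar R) :
  completion_measurable_fun m f ->
  exists (Z : set T) (f' : T -> \bar R), [/\ measurable Z, m Z = 0,
    measurable_fun setT f' & forall x, ~ Z x -> f x = f' x].
Proof.
move=> cf.
have /choice[BM BMP] : forall q : rat, exists BM : set T * set T,
    [/\ measurable BM.1, measurable BM.2, m BM.2 = 0 &
      forall x, ~ BM.2 x -> BM.1 x <-> (ratr q)%:E < f x].
  move=> q; have [|B [N [mB [M [mM M0 NM]] fE]]] := cf `](ratr q)%:E, +oo]%classic.
    exact: emeasurable_itv.
  exists (B, M); split => //= x Mx; split.
    by move=> Bx; have : (B `|` N) x by [left]; rewrite -fE /= in_itv/= leey andbT.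
  move=> qf; have : (f @^-1` `](ratr q)%:E, +oo]%classic) x.
    by rewrite /= in_itv/= leey andbT.
  by rewrite fE => -[//|/NM].
pose N (n : nat) := if unpickle n is Some q then (BM q).2 else set0.
have mN n : measurable (N n).
  by rewrite /N; case: unpickle => // q; case: (BMP q).
pose Z := \bigcup_n N n.
have mZ : measurable Z by exact: bigcupT_measurable.
have Zq q x : (BM q).2 x -> Z x by move=> Bx; exists (pickle q); [exact: I|rewrite /N pickleK].
have Z0 : m Z = 0.
  apply/negligibleP => //; apply: negligible_bigcup => n; apply/negligibleP => //.
  by rewrite /N; case: unpickle => [q|]; [case: (BMP q)|rewrite measure0].
exists Z, (fun x => if x \in Z then 0 else f x); split => //; last first.
  by move=> x Zx; rewrite memNset.
apply: (measurability _ (ErealGenOInfty.measurableE R)) => // _ [_ [r ->] <-].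
rewrite setTI (_ : _ @^-1` _ =
   (\bigcup_(q : rat) (if r%:E <= (ratr q)%:E then (BM q).1 `\` Z else set0)) `|`
   (if r%:E < 0 then Z else set0)).
  apply: measurableU; last by case: ifP.
  apply: bigcupT_measurable_rat => q; case: ifP => // _.
  by apply: measurableD => //; case: (BMP q).
apply/seteqP; split => x /=; rewrite in_itv/= andbT.
  case: ifPn => [/set_mem Zx r0|/negP Zx rf]; first by right; rewrite r0.
  left; pose y := (if f x is s%:E then s else r + 1)%R.
  have ry : (r < y)%R.
    by rewrite /y; case: (f x) rf => [s||]//; rewrite ?lte_fin// ltrDl.
  have yf : y%:E <= f x by rewrite /y; case: (f x) rf => [s||]//; rewrite leey.
  have [q] := rat_in_itvoo ry; rewrite in_itv/= => /andP[rq qy].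
  exists q => //.
  have -> : r%:E <= (ratr q)%:E :> \bar R by rewrite lee_fin ltW.
  split; last by move/mem_set.
  have [_ _ _ H] := BMP q; apply/H; first by move=> /Zq /mem_set.
  by apply: lt_le_trans yf; rewrite lte_fin.
move=> [[q _]|].
  case: ifP => // rq [Bx Zx]; rewrite memNset//.
  apply: le_lt_trans rq _; have [_ _ _ H] := BMP q; apply/H => // Mx.
  exact: Zx (Zq _ _ Mx).
by case: ifP => // r0 Zx; rewrite mem_set.
Qed.

Section calculus_of_weak_upper_gradients.
Context (R : realType) (X : completeMetricType R).
Context (m : {measure set (borelType X) -> \bar R}) (p : R) (p1 : (1 <= p)%R).
Implicit Types (rho sigma : borelType X -> \bar R) (c : curve X).
Implicit Types (f g h : X -> \bar R) (s t u : R).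

Lemma WUG_frozen_coefficient h rho (W : borelType X -> R) (M : R) :
  finite_energy m p rho -> measurable_fun setT W ->
  (forall x, 0 <= W x <= M)%R ->
  curve_ae m p (fun c => nonconstant c -> finite_along h c /\
    forall t (e : R), (curve_start c <= t <= curve_stop c)%R -> (0 < e)%R ->
    \forall u \near t, (curve_start c <= u <= curve_stop c)%R ->
      `|along h c u - along h c t|%:E <=
        (W (curve_ext c t) + e)%:E *
          \int[arclength_measure c]_(v in between t u) rho (curve_ext c v)) ->
  WUG m p h (fun x => (W x)%:E * rho x).
Proof.
move=> er mW WM ae.
have M0 : (0 <= M)%R by case/andP: (WM point); exact: le_trans.
have -> : (fun x => (W x)%:E * rho x) =
    (fun x => (W x)%:E * rho x + (0 : R)%:E * rho x).
  by apply/funext => x; rewrite mul0e adde0.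
apply: (WUG_frozen_coefficients p1 (W2 := fun=> 0%R) (M := M)) => //.
  by move=> x; rewrite lexx.
apply: curve_ae_mono ae => c H ncc; have [fin loc] := H ncc; split => //.
move=> t e tab e0; apply: filterS (loc t e tab e0) => u Hu uab.
apply: le_trans (Hu uab) _; rewrite leeDl// add0r mule_ge0 ?lee_fin ?(ltW e0)//.
by apply: integral_ge0 => v _; case: er => -[_ r0] _; exact: r0.
Qed.

Section values.
Context (f f' : X -> \bar R) (Z : set (borelType X)).
Hypotheses (mZ : measurable Z) (Z0 : m Z = 0).
Hypothesis (mf' : measurable_fun setT (f' : borelType X -> \bar R)).
Hypothesis (ff' : forall x, ~ Z x -> f x = f' x).

(** The infinite values are added to N because almost no nonconstant curve
meets them. *)
Definition exceptional_set (N : set R) : set (borelType X) :=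
  [set x | (EFin @` N `|` [set -oo; +oo]) (f' x)] `\` Z.

Lemma measurable_exceptional_set (N : set R) : measurable N ->
  measurable (exceptional_set N).
Proof.
move=> mN; apply: measurableD => //; rewrite -[X in measurable X]setTI.
apply: mf' => //; apply: measurableU; first exact: measurable_image_EFin.
by apply: measurableU; exact: emeasurable_set1.
Qed.

Lemma not_exceptional (N : set R) x : ~ Z x -> ~ exceptional_set N x ->
  exists2 r, f x = r%:E & ~ N r.
Proof.
move=> Zx Ex; have Hx : ~ (EFin @` N `|` [set -oo; +oo]) (f' x).
  by move=> Hx; apply: Ex.
rewrite (ff' Zx); case: (f' x) Hx => [r||] Hx.
- by exists r => // Nr; apply: Hx; left; exists r.
- by exfalso; apply: Hx; right; right.
- by exfalso; apply: Hx; right; left.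
Qed.

Lemma exceptional_setP (N : set R) x : ~ Z x -> `|f x| = +oo \/ (EFin @` N) (f x) ->
  exceptional_set N x.
Proof.
move=> Zx H; split => //; rewrite /= -(ff' Zx).
by case: H => [|H]; [case: (f x) => [r||]//= _; right; [right|left]|left].
Qed.

Lemma WUG_drop_exceptional (N : set R) rho : measurable N ->
  lebesgue_measure N = 0 -> WUG m p f rho ->
  WUG m p f (fun x => (\1_(~` exceptional_set N) x)%:E * rho x).
Proof.
move=> mN N0 fr; apply: (WUG_drop_null_values p1 fr _ mN N0).
  exact: measurable_exceptional_set.
apply: curve_ae_mono (WUG_along p1 fr) => c H ncc t [/=].
have [fin _] := H ncc; rewrite /along => Hx Zx; have := fin t.
move: Hx; rewrite -(ff' Zx) => -[[r Nr <-]|[->|->]]//.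
Qed.

Lemma minimal_WUG_exceptional (N : set R) rho : measurable N ->
  lebesgue_measure N = 0 -> minimal_WUG m p f rho ->
  {ae m, forall x, exceptional_set N x -> rho x = 0}.
Proof.
move=> mN N0 minr; have [fr _] := minr; have [[_ r0] _ _] := fr.
have := minimal_WUG_le p1 minr (WUG_drop_exceptional mN N0 fr).
apply: filterS => x rx Ex; apply/eqP; rewrite eq_le r0 andbT.
by apply: le_trans rx _; rewrite indicE in_setC mem_set//= mul0e.
Qed.

Lemma ae_off_null : {ae m, forall x, ~ Z x}.
Proof. by exists Z; split => // x /= /contrapT. Qed.

End values.
End calculus_of_weak_upper_gradients.

Section chain_rule.
Context (R : realType) (X : completeMetricType R).
Context (m : {measure set (borelType X) -> \bar R}) (p : R) (p1 : (1 <= p)%R).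
Implicit Types (rho sigma : borelType X -> \bar R) (c : curve X).
Implicit Types (s t u : R).

Definition real_comp (phi : R -> R) (f : X -> \bar R) (x : X) : \bar R :=
  if f x is r%:E then (phi r)%:E else 0.

Lemma along_real_comp phi f c : finite_along f c ->
  finite_along (real_comp phi f) c /\
  forall t, along (real_comp phi f) c t = phi (along f c t).
Proof.
by move=> fin; split => t; have := fin t; rewrite /along /real_comp;
  case: (f (curve_ext c t)).
Qed.

Context (f f' : X -> \bar R) (Z : set (borelType X)).
Hypothesis (mZ : measurable Z).
Hypothesis (mf' : measurable_fun setT (f' : borelType X -> \bar R)).
Hypothesis (ff' : forall x, ~ Z x -> f x = f' x).
Context (phi : R -> R) (M : R).
Hypothesis phiM : forall x y, (`|phi x - phi y| <= M * `|x - y|)%R.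
Context (N : set R) (D : R -> R).
Hypotheses (mN : measurable N) (N0 : lebesgue_measure N = 0).
Hypothesis mD : measurable_fun setT D.
Hypothesis dphi : forall x, ~ N x -> is_derive x (1 : R)%R phi (D x).

Let E := exceptional_set f' Z N.
Let mE : measurable E. Proof. exact: measurable_exceptional_set. Qed.
Let slope (x : borelType X) : R := `|D (fine (f' x))|%R.

Let mslope : measurable_fun setT slope.
Proof.
apply: measurableT_comp => //; apply: (measurableT_comp mD).
exact: (measurableT_comp (fine_measurable measurableT) mf').
Qed.

Let M0 : (0 <= M)%R. Proof. exact: lipschitz_constant_ge0 phiM. Qed.

(** M is a valid coefficient where phi has no derivative; the minimum keeps the
coefficient bounded. *)
Definition chain_coefficient (x : borelType X) : R :=
  if x \in Z `|` E then M else Num.min (slope x) M.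

Let slope_along c t : ~ (Z `|` E) (curve_ext c t) -> finite_along f c ->
  is_derive (along f c t) (1 : R)%R phi (D (along f c t)) /\
  slope (curve_ext c t) = `|D (along f c t)|%R.
Proof.
move=> ZEx fin; have Zx : ~ Z (curve_ext c t) by move=> Zx; apply: ZEx; left.
have Ex : ~ E (curve_ext c t) by move=> Ex; apply: ZEx; right.
have [r fr Nr] := not_exceptional ff' Zx Ex.
by rewrite /slope -(ff' Zx) /along fr /=; split => //; exact: dphi.
Qed.

(** Off the exceptional set the increments of phi o f along a curve are those of
f times at most the modulus of the derivative, up to an error that is small
compared with them. *)
Lemma WUG_chain rho : WUG m p f rho ->
  WUG m p (real_comp phi f)
    (fun x => (chain_coefficient x)%:E * ((\1_(~` E) x)%:E * rho x)).
Proof.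
move=> fr.
have fr' := WUG_drop_exceptional p1 mZ mf' ff' mN N0 fr; rewrite -/E in fr'.
set rho' := (fun x => _) in fr'.
have [[_ r0] _ _] := fr'.
have er' := WUG_finite_energy fr'.
apply: (WUG_frozen_coefficient p1 (M := M)) => //.
- apply: measurable_fun_ifT => //; last exact: measurable_minr.
  apply: (@measurable_fun_bool _ _ _ _ true).
  rewrite setTI (_ : _ @^-1` _ = Z `|` E); first exact: measurableU.
  by apply/seteqP; split => x /=; [exact: set_mem|exact: mem_set].
- move=> x; rewrite /chain_coefficient; case: ifP => _; first by rewrite M0 lexx.
  by rewrite le_min normr_ge0 M0 ge_min lexx orbT.
have := curve_aeI p1 (WUG_along p1 fr') (curve_ae_line_integral er').
apply: curve_ae_mono => c [H lr] ncc; have ug := H ncc.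
have [fin _] := ug; have [fing gE] := along_real_comp phi fin.
split => // t e tab e0.
have ball0 : \forall u \near t, (curve_start c <= u <= curve_stop c)%R ->
    (`|phi (along f c u) - phi (along f c t)| <=
     (chain_coefficient (curve_ext c t) + e) * `|along f c u - along f c t|)%R.
  have Mle u : (`|phi (along f c u) - phi (along f c t)| <=
      (M + e) * `|along f c u - along f c t|)%R.
    by apply: le_trans (phiM _ _) _; rewrite ler_wpM2r// lerDl ltW.
  have [ZEx|ZEx] := pselect ((Z `|` E) (curve_ext c t)).
    apply/nbhs_ballP; exists 1%R => //= u _ _.
    by rewrite /chain_coefficient mem_set.
  have [dF sF] := slope_along ZEx fin.
  have /nbhs_ballP[d /= d0 Hd] := is_derive_abs_increment dF e0.
  apply: filterS (ug_along_continuous er'.1 lr ug tab d0) => u Fu uab.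
  rewrite /chain_coefficient memNset// sF.
  have [DM|MD] := leP `|D (along f c t)|%R M; last exact: Mle.
  have Bu : ball (along f c t) d (along f c u) by rewrite /ball/= distrC; exact: Fu.
  by have [] := Hd _ Bu.
apply: filterS ball0 => u Hu uab; rewrite !gE.
apply: (@le_trans _ _ ((chain_coefficient (curve_ext c t) + e)%:E *
    `|along f c u - along f c t|%:E)).
  by rewrite -EFinM lee_fin; exact: Hu.
apply: lee_wpmul2l; last exact: ug_along_between ug tab uab.
rewrite lee_fin addr_ge0 ?(ltW e0)// /chain_coefficient.
by case: ifP => _ //; rewrite le_min normr_ge0 M0.
Qed.

(** Conversely f is recovered from phi o f with the reciprocal coefficient where
the derivative is bounded away from zero. *)
Lemma WUG_chain_inverse (n : nat) rho sigma
    (A := [set x | (n.+1%:R^-1 <= slope x)%R] `\` (Z `|` E)) :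
  WUG m p f rho -> WUG m p (real_comp phi f) sigma ->
  WUG m p f (fun x => (\1_A x * (slope x)^-1)%:E * sigma x +
    (\1_(~` A) x)%:E * rho x).
Proof.
move=> fr gs.
have mA : measurable A.
  apply: measurableD; last exact: measurableU.
  rewrite -[X in measurable X]setTI.
  have := mslope measurableT (measurable_itv `[(n.+1%:R^-1)%R, +oo[).
  rewrite !setTI (_ : _ @^-1` _ = [set x | (n.+1%:R^-1 <= slope x)%R])//.
  by apply/seteqP; split => x /=; rewrite in_itv/= andbT.
have er := WUG_finite_energy fr; have es := WUG_finite_energy gs.
have [[_ r0] _] := er; have [[_ s0] _] := es.
have sE x : ((slope x)^-1 = slope x `^ (-1))%R by rewrite powR_inv1 ?normr_ge0.
have Ain x : x \in A -> (n.+1%:R^-1 <= slope x)%R by rewrite inE => -[].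
have W1M x : (0 <= \1_A x * (slope x)^-1 <= n.+1%:R)%R.
  rewrite indicE; case: (boolP (x \in A)) => /= [/Ain sx|_].
    rewrite mul1r invr_ge0 normr_ge0/= -[leRHS]invrK.
    by rewrite lef_pV2 ?posrE// (lt_le_trans _ sx).
  by rewrite mul0r lexx ler0n.
apply: (WUG_frozen_coefficients p1 (M := n.+1%:R)) => //.
- apply: measurable_funM; first exact: measurable_indicR.
  under eq_fun do rewrite sE.
  exact: (measurableT_comp (measurable_powR _) mslope).
- by apply: measurable_indicR; exact: measurableC.
- move=> x; have /andP[-> /le_trans] := indic01 (R:=R) (~` A) x; apply.
  by rewrite ler1n.
have := curve_aeI p1 (WUG_along p1 gs)
  (curve_aeI p1 (WUG_along p1 fr) (curve_ae_line_integral er)).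
apply: curve_ae_mono => c [Hs [Hr lr]] ncc; have ugs := Hs ncc; have ug := Hr ncc.
have [fin _] := ug; have [fing gE] := along_real_comp phi fin.
split => // t e tab e0.
have is0 u : 0 <= \int[arclength_measure c]_(v in between t u) sigma (curve_ext c v).
  by apply: integral_ge0 => v _.
have ir0 u : 0 <= \int[arclength_measure c]_(v in between t u) rho (curve_ext c v).
  by apply: integral_ge0 => v _.
rewrite !indicE in_setC.
case: (boolP (curve_ext c t \in A)) => /= [tA|_]; last first.
  apply/nbhs_ballP; exists 1%R => //= u _ uab.
  rewrite mul0r add0r.
  apply: le_trans (ug_along_between ug tab uab) _.
  rewrite -[leLHS]add0e; apply: leeD; first by rewrite mule_ge0// lee_fin ltW.
  by rewrite -[leLHS]mul1e lee_wpmul2r// lee_fin lerDl ltW.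
have [sn ZEx] := set_mem tA.
have [dF sF] := slope_along ZEx fin.
rewrite mul1r add0r; set a := slope _ in sn sF *.
have a0 : (0 < a)%R by apply: lt_le_trans sn; rewrite invr_gt0.
(* If increments of phi are at least (a - d) times increments of f, the latter
   are at most (a^-1 + e) times the former. *)
have [d d0 dae] : exists2 d, (0 < d)%R & (1 <= (a^-1 + e) * (a - d))%R.
  exists (a - (a^-1 + e)^-1)%R.
    rewrite subr_gt0 -[ltRHS]invrK ltf_pV2 ?posrE ?invr_gt0//.
      by rewrite ltrDl.
    by rewrite addr_gt0// invr_gt0.
  by rewrite subKr divff// gt_eqF// addr_gt0// invr_gt0.
have /nbhs_ballP[d1 /= d10 Hd] := is_derive_abs_increment dF d0.
apply: filterS (ug_along_continuous er.1 lr ug tab d10) => u Fu uab.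
have Bu : ball (along f c t) d1 (along f c u) by rewrite /ball/= distrC; exact: Fu.
have [_] := Hd _ Bu; rewrite -sF -/a => Dle.
apply: (@le_trans _ _ ((a^-1 + e)%:E *
    `|phi (along f c u) - phi (along f c t)|%:E)).
  rewrite -EFinM lee_fin; apply: (@le_trans _ _
    ((a^-1 + e) * ((a - d) * `|along f c u - along f c t|)))%R.
    by rewrite mulrA -[leLHS]mul1r ler_wpM2r.
  apply: ler_wpM2l; first by rewrite addr_ge0 ?invr_ge0// ltW.
  by rewrite mulrBl lerBlDr.
rewrite -[leLHS]adde0; apply: leeD; last by rewrite mule_ge0// lee_fin ltW.
apply: lee_wpmul2l; first by rewrite lee_fin ltW// addr_gt0// invr_gt0.
by have := ug_along_between ugs tab uab; rewrite !gE.
Qed.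

End chain_rule.

Section rules.
Context (R : realType) (X : completeMetricType R).
Context (m : {measure set (borelType X) -> \bar R}) (p : R) (p1 : (1 <= p)%R).
Implicit Types (rho sigma : borelType X -> \bar R) (c : curve X).
Implicit Types (s t u : R).

Lemma minimal_WUG_null_values (f : borelType X -> \bar R) (N : set R) rho :
  completion_measurable_fun m f -> measurable N -> lebesgue_measure N = 0 ->
  minimal_WUG m p f rho ->
  {ae m, forall x, `|f x| = +oo \/ (EFin @` N) (f x) -> rho x = 0}.
Proof.
move=> /completion_measurable_Borel[Z [f' [mZ Z0 mf' ff']]] mN N0 minr.
have := minimal_WUG_exceptional p1 mZ mf' ff' mN N0 minr.
apply: filterS2 (ae_off_null mZ Z0) => x Zx Ex H; apply: Ex.
exact: (exceptional_setP ff' Zx H).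
Qed.

Lemma lipschitz_bound (phi : R -> R) : lipschitz phi ->
  exists M : R, forall x y, (`|phi x - phi y| <= M * `|x - y|)%R.
Proof.
move=> /pinfty_ex_gt0[M M0 H]; exists M => x y.
exact: (H (x, y)).
Qed.

Lemma WUG_real_comp (f : borelType X -> \bar R) (phi : R -> R) :
  completion_measurable_fun m f -> WUG m p f !=set0 -> lipschitz phi ->
  WUG m p (real_comp phi f) !=set0.
Proof.
move=> /completion_measurable_Borel[Z [f' [mZ Z0 mf' ff']]] [rho fr].
move=> /lipschitz_bound[M phiM].
have [N [D [mN N0 mD dphi]]] := lipschitz_ae_is_derive phiM.
have H := WUG_chain p1 mZ mf' ff' phiM mN N0 mD dphi fr.
by eexists; exact: H.
Qed.

(** The upper bound is the minimality of sigma. For the lower bound, the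
minimality of rho gives |phi'(f)| rho <= sigma where |phi'(f)| >= 1 / (n + 1), for
every n; on the exceptional set both sides vanish. *)
Lemma minimal_WUG_real_comp (f : borelType X -> \bar R) (phi : R -> R) rho sigma :
  completion_measurable_fun m f -> lipschitz phi ->
  minimal_WUG m p f rho -> minimal_WUG m p (real_comp phi f) sigma ->
  {ae m, forall x,
    (forall r : R, f x = r%:E -> sigma x = lip phi r * rho x) /\
    (`|f x| = +oo -> sigma x = 0)}.
Proof.
move=> /completion_measurable_Borel[Z [f' [mZ Z0 mf' ff']]].
move=> /lipschitz_bound[M phiM] minr mins.
have [N [D [mN N0 mD dphi]]] := lipschitz_ae_is_derive phiM.
have [fr _] := minr; have [gs _] := mins.
have [[_ r0] _ _] := fr; have [[_ s0] _ _] := gs.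
have up := minimal_WUG_le p1 mins
  (WUG_chain p1 mZ mf' ff' phiM mN N0 mD dphi fr).
have Er := minimal_WUG_exceptional p1 mZ mf' ff' mN N0 minr.
have lo := ae_foralln (fun n => minimal_WUG_le p1 minr
  (WUG_chain_inverse p1 mZ mf' ff' mN mD dphi n fr gs)).
apply: filterS2 lo (filterI (ae_off_null mZ Z0) (filterI up Er)).
move=> x lox [Zx [upx Ex]].
have exc : exceptional_set f' Z N x -> sigma x = 0 /\ rho x = 0.
  move=> Exx; split; last exact: Ex.
  apply/eqP; rewrite eq_le s0 andbT; apply: le_trans upx _.
  by rewrite Ex// !mule0.
split=> [r fxr|foo]; last first.
  by apply: (exc _).1; apply: (exceptional_setP ff' Zx); left.
have [Nr|Nr] := pselect (N r).
  have [-> ->] : sigma x = 0 /\ rho x = 0.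
    by apply: exc; apply: (exceptional_setP ff' Zx); right; exists r.
  by rewrite mule0.
have Exx : ~ exceptional_set f' Z N x.
  by move=> [+ _]; rewrite /= -(ff' _ Zx) fxr => -[[r' Nr' [rr']]|[]//];
    apply: Nr; rewrite -rr'.
have ZEx : x \notin Z `|` exceptional_set f' Z N.
  by apply/negP => /set_mem [].
have slope_x : D (fine (f' x)) = D r by rewrite -(ff' _ Zx) fxr.
rewrite (lip_is_derive (dphi _ Nr)).
apply/eqP; rewrite eq_le; apply/andP; split.
  apply: le_trans upx _; rewrite /chain_coefficient (negbTE ZEx) slope_x.
  rewrite indicE in_setC memNset//= mul1e; apply: lee_wpmul2r => //.
  by rewrite lee_fin ge_min lexx.
have [->|D0] := eqVneq (D r) 0%R; first by rewrite normr0 mul0e.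
have a0 : (0 < `|D r|)%R by rewrite normr_gt0.
near \oo => n.
have nD : (n.+1%:R^-1 <= `|D r|)%R.
  by apply: ltW; near: n; exact: near_infty_natSinv_lt (PosNum a0).
have xA : x \in [set x | (n.+1%:R^-1 <= `|D (fine (f' x))|)%R] `\`
    (Z `|` exceptional_set f' Z N).
  by rewrite inE; split; [rewrite /= slope_x|move/mem_set; exact/negP].
have := lox n; rewrite !indicE in_setC xA /= slope_x mul1r mul0e adde0 => rs.
apply: le_trans (lee_wpmul2l _ rs) _; first by rewrite lee_fin ltW.
by rewrite muleA -EFinM mulfV ?mul1e// gt_eqF.
Unshelve. all: by end_near. Qed.

(** * Locality *)

Lemma along_finite (f : X -> \bar R) c t : finite_along f c ->
  f (curve_ext c t) = (along f c t)%:E.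
Proof. by move=> fin; rewrite /along fineK. Qed.

Lemma nonneg_integral_along rho c (A : set (measurableTypeR R)) :
  nonneg_borel rho -> 0 <= \int[arclength_measure c]_(v in A) rho (curve_ext c v).
Proof. by move=> [_ r0]; apply: integral_ge0 => v _. Qed.

(** Applies to the difference f - g and to the excess of |f| + |g| over a
constant. *)
Lemma WUG_increments_le (f g h : X -> \bar R) rho sigma :
  WUG m p f rho -> WUG m p g sigma ->
  (forall c, finite_along f c -> finite_along g c -> finite_along h c /\
    forall t u, (`|along h c u - along h c t| <=
      `|along f c u - along f c t| + `|along g c u - along g c t|)%R) ->
  WUG m p h (fun x => (1 : R)%:E * rho x + (1 : R)%:E * sigma x).
Proof.
move=> fr gs H; have er := WUG_finite_energy fr; have es := WUG_finite_energy gs.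
apply: (WUG_frozen_coefficients p1 (W1 := fun=> 1%R) (W2 := fun=> 1%R) (M := 1)) => //.
- by move=> x; rewrite ler01 lexx.
- by move=> x; rewrite ler01 lexx.
have := curve_aeI p1 (WUG_along p1 fr) (WUG_along p1 gs).
apply: curve_ae_mono => c [Hf Hg] ncc; have ugf := Hf ncc; have ugg := Hg ncc.
have [finh hL] := H c ugf.1 ugg.1; split => // t e tab e0.
apply/nbhs_ballP; exists 1%R => //= u _ uab.
apply: (@le_trans _ _ (`|along f c u - along f c t|%:E +
    `|along g c u - along g c t|%:E)).
  by rewrite -EFinD lee_fin.
have le1 (I0 : \bar R) : 0 <= I0 -> I0 <= (1 + e)%:E * I0.
  by move=> I00; rewrite -[leLHS]mul1e lee_wpmul2r// lee_fin lerDl ltW.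
apply: leeD.
  apply: le_trans (ug_along_between ugf tab uab) _; apply: le1.
  by apply: nonneg_integral_along; case: er.
apply: le_trans (ug_along_between ugg tab uab) _; apply: le1.
by apply: nonneg_integral_along; case: es.
Qed.

Lemma along_sub (f g h : X -> \bar R) c :
  (forall x, f x +? - g x -> h x = f x - g x) ->
  finite_along f c -> finite_along g c -> finite_along h c /\
  forall t, along h c t = (along f c t - along g c t)%R.
Proof.
move=> hfg ff fg; have hE t : h (curve_ext c t) = (along f c t - along g c t)%:E.
  by rewrite hfg (along_finite t ff) (along_finite t fg).
by split => t; rewrite ?/along hE.
Qed.

Lemma WUG_sub (f g h : X -> \bar R) :
  WUG m p f !=set0 -> WUG m p g !=set0 ->
  (forall x, f x +? - g x -> h x = f x - g x) -> WUG m p h !=set0.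
Proof.
move=> [rho fr] [sigma gs] hfg; eexists; apply: (WUG_increments_le fr gs).
move=> c ff fg; have [fh hE] := along_sub hfg ff fg; split => // t u.
rewrite !hE; apply: le_trans (ler_normB _ _).
by rewrite [X in (_ <= `|X|)%R](_ : _ =
  along f c u - along g c u - (along f c t - along g c t))%R//; lra.
Qed.

(** On curves, h = f - g takes only the value 0 where f = g, and one value is a
null set. *)
Lemma minimal_WUG_sub_local (f g h : borelType X -> \bar R) rho :
  completion_measurable_fun m f -> completion_measurable_fun m g ->
  WUG m p f !=set0 -> WUG m p g !=set0 ->
  (forall x, f x +? - g x -> h x = f x - g x) ->
  minimal_WUG m p h rho -> {ae m, forall x, f x = g x -> rho x = 0}.
Proof.
move=> /completion_measurable_Borel[Z [f' [mZ Z0 mf' ff']]].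
move=> /completion_measurable_Borel[Y [g' [mY Y0 mg' gg']]].
move=> [sf fsf] [sg gsg] hfg minr; have [hr _] := minr.
have [[_ r0] _ _] := hr.
pose E : set (borelType X) := [set x | f' x = g' x] `\` (Z `|` Y).
have mE : measurable E.
  apply: measurableD; last exact: measurableU.
  by rewrite -[X in measurable X]setTI; exact: measurable_eqe.
have aeE : curve_ae m p (fun c => nonconstant c ->
    forall t, E (curve_ext c t) -> [set 0%R] (along h c t)).
  have := curve_aeI p1 (WUG_along p1 fsf) (WUG_along p1 gsg).
  apply: curve_ae_mono => c [Hf Hg] ncc t [/= fg ZY].
  have [fin_f _] := Hf ncc; have [fin_g _] := Hg ncc.
  have [_ ->] := along_sub hfg fin_f fin_g.
  have Zx : ~ Z (curve_ext c t) by move=> ?; apply: ZY; left.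
  have Yx : ~ Y (curve_ext c t) by move=> ?; apply: ZY; right.
  by rewrite /along (ff' _ Zx) (gg' _ Yx) fg subrr.
have := minimal_WUG_le p1 minr (WUG_drop_null_values p1 hr mE
  (measurable_set1 _) (lebesgue_measure_set1 _) aeE).
apply: filterS2 (filterI (ae_off_null mZ Z0) (ae_off_null mY Y0)) => x [Zx Yx] rx fgx.
apply/eqP; rewrite eq_le r0 andbT; apply: le_trans rx _.
rewrite indicE in_setC mem_set ?mul0e//.
by split; [rewrite /= -(ff' _ Zx) -(gg' _ Yx)|case].
Qed.

End rules.

(** * Leibniz rule *)

Section leibniz.
Context (R : realType) (X : completeMetricType R).
Context (m : {measure set (borelType X) -> \bar R}) (p : R) (p1 : (1 <= p)%R).
Implicit Types (rho sigma : borelType X -> \bar R) (c : curve X).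
Implicit Types (s t u : R).

Lemma along_mul (f g h : X -> \bar R) c :
  (forall x, f x *? g x -> h x = f x * g x) ->
  finite_along f c -> finite_along g c -> finite_along h c /\
  forall t, along h c t = (along f c t * along g c t)%R.
Proof.
move=> hfg ff fg; have hE t : h (curve_ext c t) = (along f c t * along g c t)%:E.
  by rewrite hfg (along_finite t ff) (along_finite t fg).
by split => t; rewrite ?/along hE.
Qed.

(** The excess of |f| + |g| over the bound has a weak upper gradient and vanishes
almost everywhere, hence along almost every curve. *)
Lemma curve_ae_bounded (f g : borelType X -> \bar R) (C : R) :
  WUG m p f !=set0 -> WUG m p g !=set0 ->
  {ae m, forall x, `|f x| + `|g x| <= C%:E} ->
  curve_ae m p (fun c => nonconstant c ->
    forall t, (`|along f c t| + `|along g c t| <= C)%R).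
Proof.
move=> [rho fr] [sigma gs] fgC.
pose q (x : borelType X) : \bar R := (Num.max (`|fine (f x)| + `|fine (g x)| - C) 0)%:E.
have qN : WUG m p q !=set0.
  eexists; apply: (WUG_increments_le p1 fr gs) => c _ _.
  split => [t|t u]; first by rewrite /q.
  have qE v : along q c v =
      Num.max (`|along f c v| + `|along g c v| - C)%R 0%R by [].
  rewrite !qE.
  move: (along f c u) (along f c t) (along g c u) (along g c t) => a b a' b'.
  have := lerB_dist a b; have := lerB_dist b a.
  have := lerB_dist a' b'; have := lerB_dist b' a'.
  rewrite (distrC b a) (distrC b' a').
  move: `|a - b|%R `|a' - b'|%R `|a|%R `|b|%R `|a'|%R `|b'|%R => d d' x y x' y'.
  move=> h1 h2 h3 h4; rewrite ler_norml.
  have [k1|k1] := leP (x + x' - C)%R 0%R; have [k2|k2] := leP (y + y' - C)%R 0%R;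
    apply/andP; split; lra.
have q0 : {ae m, forall x, q x = 0}.
  apply: filterS fgC => x; rewrite /q; case: (f x) (g x) => [a||] [b||]//=.
  rewrite -EFinD lee_fin => abC; rewrite max_r// subr_le0.
  exact: abC.
have := curve_aeI p1 (WUG_ae_zero p1 qN q0) (curve_ae_rectifiable m p1).
apply: curve_ae_mono => c [H _] ncc t; have [/eqP] := H ncc t.
by rewrite eq_le ge_max subr_le0 => /andP[/andP[]].
Qed.

Section product.
Context (f g h : borelType X -> \bar R) (f' g' : borelType X -> \bar R) (C : R).
Context (Z Y : set (borelType X)).
Hypotheses (mZ : measurable Z) (mf' : measurable_fun setT f').
Hypothesis (ff' : forall x, ~ Z x -> f x = f' x).
Hypotheses (mY : measurable Y) (mg' : measurable_fun setT g').
Hypothesis (gg' : forall x, ~ Y x -> g x = g' x).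
Hypothesis fgC : {ae m, forall x, `|f x| + `|g x| <= C%:E}.
Hypothesis hfg : forall x, f x *? g x -> h x = f x * g x.

(** The coefficient |k|, kept bounded. On the null set A, where the Borel
representative k says nothing about the original function, it takes the bound
that holds along almost every curve. *)
Definition truncated_abs (k : borelType X -> \bar R) (A : set (borelType X)) x : R :=
  if x \in A then `|C|%R else Num.min `|fine (k x)|%R `|C|%R.

Let truncated_abs_bound k A x : (0 <= truncated_abs k A x <= `|C|)%R.
Proof.
rewrite /truncated_abs; case: ifP => _; first by rewrite normr_ge0 lexx.
by rewrite le_min !normr_ge0 ge_min lexx orbT.
Qed.

Let measurable_truncated_abs k A : measurable A -> measurable_fun setT k ->
  measurable_fun setT (truncated_abs k A).
Proof.
move=> mA mk; apply: measurable_fun_ifT => //.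
  apply: (@measurable_fun_bool _ _ _ _ true).
  rewrite setTI (_ : _ @^-1` _ = A)//.
  by apply/seteqP; split => x /=; [exact: set_mem|exact: mem_set].
apply: measurable_minr => //; apply: measurableT_comp => //.
exact: (measurableT_comp (fine_measurable measurableT) mk).
Qed.

(** F(u)G(u) - F(t)G(t) = F(t)(G(u) - G(t)) + G(u)(F(u) - F(t)), and G(u) is close
to G(t) by continuity along the curve. *)
Lemma WUG_mul rho sigma : WUG m p f rho -> WUG m p g sigma ->
  WUG m p h (fun x => (truncated_abs f' Z x)%:E * sigma x +
    (truncated_abs g' Y x)%:E * rho x).
Proof.
move=> fr gs; have er := WUG_finite_energy fr; have es := WUG_finite_energy gs.
have [nr _] := er; have [ns _] := es.
apply: (WUG_frozen_coefficients p1 (M := `|C|%R)) => //.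
- exact: measurable_truncated_abs.
- exact: measurable_truncated_abs.
have bnd : curve_ae m p (fun c => nonconstant c ->
    forall t, (`|along f c t| + `|along g c t| <= C)%R).
  by apply: curve_ae_bounded => //; [exists rho|exists sigma].
have := curve_aeI p1 bnd (curve_aeI p1 (WUG_along p1 fr)
  (curve_aeI p1 (WUG_along p1 gs) (curve_ae_line_integral es))).
apply: curve_ae_mono => c [HC [Hf [Hg ls]]] ncc.
have ugf := Hf ncc; have ugg := Hg ncc; have {}HC := HC ncc.
have [fin_h hE] := along_mul hfg ugf.1 ugg.1; split => // t e tab e0.
have Cle : (C <= `|C|)%R by exact: ler_norm.
have Fle : (`|along f c t| <= truncated_abs f' Z (curve_ext c t))%R.
  have FC : (`|along f c t| <= `|C|)%R.
    by apply: le_trans Cle; apply: le_trans (HC t); rewrite lerDl.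
  rewrite /truncated_abs; case: ifPn => // /negP Zx.
  rewrite le_min FC andbT -ff'//; last by move/mem_set.
have Gle : (`|along g c t| <= truncated_abs g' Y (curve_ext c t))%R.
  have GC : (`|along g c t| <= `|C|)%R.
    by apply: le_trans Cle; apply: le_trans (HC t); rewrite lerDr.
  rewrite /truncated_abs; case: ifPn => // /negP Yx.
  rewrite le_min GC andbT -gg'//; last by move/mem_set.
apply: filterS (ug_along_continuous ns ls ugg tab e0) => u Gu uab.
rewrite !hE; set F := along f c in Fle *; set G := along g c in Gle Gu *.
have {}Gu := ltW (Gu uab).
have GuG : (`|G u| <= truncated_abs g' Y (curve_ext c t) + e)%R.
  rewrite -(subrK (G t) (G u)) addrC; apply: le_trans (ler_normD _ _) _.
  exact: lerD.
apply: (@le_trans _ _ (`|F t|%:E * `|G u - G t|%:E + `|G u|%:E * `|F u - F t|%:E)).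
  rewrite -!EFinM -EFinD lee_fin -!normrM.
  apply: le_trans (ler_normD _ _).
  by rewrite [X in (_ <= `|X|)%R](_ : _ = F u * G u - F t * G t)%R//; lra.
apply: leeD; apply: lee_pmul; rewrite ?lee_fin//.
- by apply: le_trans Fle _; rewrite lerDl ltW.
- exact: ug_along_between ugg tab uab.
- exact: ug_along_between ugf tab uab.
Qed.

End product.

Lemma WUG_mul_nonempty (f g h : borelType X -> \bar R) (C : R) :
  completion_measurable_fun m f -> completion_measurable_fun m g ->
  WUG m p f !=set0 -> WUG m p g !=set0 ->
  {ae m, forall x, `|f x| + `|g x| <= C%:E} ->
  (forall x, f x *? g x -> h x = f x * g x) -> WUG m p h !=set0.
Proof.
move=> /completion_measurable_Borel[Z [f' [mZ _ mf' ff']]].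
move=> /completion_measurable_Borel[Y [g' [mY _ mg' gg']]].
move=> [rho fr] [sigma gs] fgC hfg.
by eexists; exact: WUG_mul mZ mf' ff' mY mg' gg' fgC hfg _ _ fr gs.
Qed.

Lemma minimal_WUG_mul_le (f g h : borelType X -> \bar R) (C : R) rho sigma tau :
  completion_measurable_fun m f -> completion_measurable_fun m g ->
  {ae m, forall x, `|f x| + `|g x| <= C%:E} ->
  (forall x, f x *? g x -> h x = f x * g x) ->
  minimal_WUG m p f rho -> minimal_WUG m p g sigma -> minimal_WUG m p h tau ->
  {ae m, forall x, tau x <= `|f x| * sigma x + `|g x| * rho x}.
Proof.
move=> /completion_measurable_Borel[Z [f' [mZ Z0 mf' ff']]].
move=> /completion_measurable_Borel[Y [g' [mY Y0 mg' gg']]].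
move=> fgC hfg [fr _] [gs _] minh.
have [[_ r0] _ _] := fr; have [[_ s0] _ _] := gs.
have := minimal_WUG_le p1 minh (WUG_mul mZ mf' ff' mY mg' gg' fgC hfg fr gs).
apply: filterS2 (filterI fgC (filterI (ae_off_null mZ Z0) (ae_off_null mY Y0))).
move=> x [fgx [Zx Yx]] /le_trans; apply.
have fin (y z : \bar R) : `|y| + `|z| <= C%:E -> `|fine y|%:E = `|y|.
  by case: y z => [a||] [b||].
rewrite /truncated_abs !memNset// -(ff' _ Zx) -(gg' _ Yx).
apply: leeD; apply: lee_wpmul2r => //.
  by rewrite -(fin _ _ fgx) lee_fin ge_min lexx.
by rewrite addeC in fgx; rewrite -(fin _ _ fgx) lee_fin ge_min lexx.
Qed.

End leibniz.

(** * Calculus rules *)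

Theorem theorem6p1 (R : realType) (X : completeMetricType R)
  (sepX : separable X)
  (m : {measure set (borelType X) -> \bar R}) (finm : finite_on_bounded m)
  (p : R) (hp : (1 <= p)%R) :
  (* (i) *)
  (forall f : borelType X -> \bar R,
    completion_measurable_fun m f -> WUG m p f !=set0 ->
    forall rho_f, minimal_WUG m p f rho_f ->
      {ae m, forall x, `|f x| = +oo -> rho_f x = 0} /\
      (forall N : set R, measurable N -> lebesgue_measure N = 0 ->
        {ae m, forall x, (EFin @` N) (f x) -> rho_f x = 0})) /\
  (* (ii) *)
  ((forall (f : borelType X -> R) (phi : R -> R),
    completion_measurable_fun m f -> WUG m p (EFin \o f) !=set0 ->
    lipschitz phi ->
    let g := EFin \o (phi \o f) in
    WUG m p g !=set0 /\
    (forall rho_f rho_g,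
      minimal_WUG m p (EFin \o f) rho_f -> minimal_WUG m p g rho_g ->
      {ae m, forall x, rho_g x = lip phi (f x) * rho_f x})) /\
   (forall (f : borelType X -> \bar R) (phi : R -> R),
    completion_measurable_fun m f -> WUG m p f !=set0 ->
    lipschitz phi ->
    let g := fun x => if f x is r%:E then (phi r)%:E else 0 in
    WUG m p g !=set0 /\
    (forall rho_f rho_g,
      minimal_WUG m p f rho_f -> minimal_WUG m p g rho_g ->
      {ae m, forall x,
        (forall r : R, f x = r%:E -> rho_g x = lip phi r * rho_f x) /\
        (`|f x| = +oo -> rho_g x = 0)}))) /\
  (* (iii) *)
  (forall f g : borelType X -> \bar R,
    completion_measurable_fun m f -> completion_measurable_fun m g ->
    WUG m p f !=set0 -> WUG m p g !=set0 ->
    forall h : X -> \bar R, (forall x, f x +? - g x -> h x = f x - g x) ->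
    WUG m p h !=set0 /\
    (forall rho_h, minimal_WUG m p h rho_h ->
      {ae m, forall x, f x = g x -> rho_h x = 0})) /\
  (* (iv) *)
  (forall (f g : borelType X -> \bar R) (C : R),
    completion_measurable_fun m f -> completion_measurable_fun m g ->
    WUG m p f !=set0 -> WUG m p g !=set0 ->
    {ae m, forall x, `|f x| + `|g x| <= C%:E} ->
    forall h : X -> \bar R, (forall x, f x *? g x -> h x = f x * g x) ->
    WUG m p h !=set0 /\
    (forall rho_f rho_g rho_h,
      minimal_WUG m p f rho_f -> minimal_WUG m p g rho_g ->
      minimal_WUG m p h rho_h ->
      {ae m, forall x, rho_h x <= `|f x| * rho_g x + `|g x| * rho_f x})).
Proof.
split.
  move=> f cf _ rho minr; split.
    have := minimal_WUG_null_values hp cf measurable0 (measure0 _) minr.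
    by apply: filterS => x H foo; apply: H; left.
  move=> N mN N0.
  have := minimal_WUG_null_values hp cf mN N0 minr.
  by apply: filterS => x H Nfx; apply: H; right.
split; [split|split].
- move=> f phi cf ef lphi g.
  have cF : completion_measurable_fun m (EFin \o f).
    move=> Y mY; apply: (cf (EFin @^-1` Y)).
    by rewrite -[X in measurable X]setTI; exact: EFin_measurable.
  split; first exact: (WUG_real_comp (f := EFin \o f) (phi := phi) hp cF ef lphi).
  move=> rho_f rho_g minf ming.
  have := minimal_WUG_real_comp (f := EFin \o f) (phi := phi) hp cF lphi minf ming.
  by apply: filterS => x [H _]; exact: H.
- move=> f phi cf ef lphi g; split.
    exact: (WUG_real_comp (f := f) (phi := phi) hp cf ef lphi).
  by move=> rho_f rho_g minf ming;
    exact: (minimal_WUG_real_comp (f := f) (phi := phi) hp cf lphi minf ming).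
- move=> f g cf cg ef eg h hfg; split; first exact: (WUG_sub hp ef eg hfg).
  by move=> rho_h minh; exact: (minimal_WUG_sub_local hp cf cg ef eg hfg minh).
- move=> f g C cf cg ef eg fgC h hfg.
  split; first exact: (WUG_mul_nonempty hp cf cg ef eg fgC hfg).
  move=> rho_f rho_g rho_h minf ming minh.
  exact: (minimal_WUG_mul_le hp cf cg fgC hfg minf ming minh).
Qed.
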